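(* Let $T=(T,S,+F)$ be a positive simple BY tree satisfying parity condition (B), and suppose that $S$ consists of $r+1$ orbits under $F$, the product of whose sizes is $Q$. Let $T'=T/\langle F\rangle$ be the quotient tree, metrised so that an edge $e'$ of $T'$ corresponding to an $F$-orbit of $q$ edges of $T$, each of length $l(e)$, has length $l(e')=l(e)/q$. Then \[c_T=Q\sum_{\{e'_1,\dots,e'_r\}}\prod_{i=1}^r l(e'_i),\] where the sum runs over all unordered $r$-tuples of distinct edges of $T'$ whose removal disconnects the $r+1$ points of $S/\langle F\rangle$ from one another.
   Context: A BY tree is a triple $T=(T,S,\epsilon F)$ where $T$ is a finite graph-theoretic tree with an edge-length function $l:E(T)\to\{1,2,3,\dots\}$, $S\subseteq T$ is a subgraph, $F$ is a length-preserving graph automorphism of $T$ with $F(S)=S$, and $\epsilon:\pi_0(T\setminus S)\to\{\pm1\}$ is a function on the connected components of the topological complement $T\setminus S$. It is simple if $S$ is a non-empty set of degree-$1$ vertices of $T$ (so $T\setminus S$ is connected); then $\epsilon$ is a single sign, and $T$ is called positive (written $(T,S,+F)$) or negative (written $(T,S,-F)$) accordingly. Let $\Lambda_T=H_1(T,S;\mathbb Z)$, viewed inside the free abelian group on oriented edges of $T$ not in $S$, with the intersection length pairing given by restricting $\langle e,e'\rangle=l(e)\delta_{e,e'}$. The signed automorphism acts isometrically on $\Lambda_T$, sending the class of a path $\gamma$ in the closure of a component $C$ of $T\setminus S$ to $\epsilon(C)[F\gamma]$. The Tamagawa number is $c_T=\#(\Lambda_T^\vee/\Lambda_T)^{\epsilon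 F}$, where $\Lambda_T^\vee=\mathrm{Hom}(\Lambda_T,\mathbb Z)$ and $\Lambda_T\hookrightarrow\Lambda_T^\vee$ is induced by the pairing. Parity condition (B): no iterate of $F$ inverts (maps to itself with endpoints swapped) any edge of $T$ of odd length. *)

(* Defs.v *)
From HB Require Import structures.
From mathcomp Require Import mathcomp_extra boolp classical_sets functions cardinality.
From mathcomp Require Import all_boot all_order all_algebra all_fingroup finmap.

Set Implicit Arguments.
Unset Strict Implicit.
Unset Printing Implicit Defensive.

Import Order.TTheory GRing.Theory Num.Theory.

Local Open Scope ring_scope.
Local Open Scope quotient_scope.

Section Trees.
Variables (V : finType) (adj : rel V).

Definition graph_edges : {set {set V}} :=
  [set [set p.1; p.2] | p : V * V & adj p.1 p.2].

(* A closed walk u, v, u along a single edge is a [ucycle] of size 2. *)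
Definition is_tree : Prop :=
  [/\ symmetric adj, irreflexive adj, (0 < #|V|)%N,
      forall u v, connect adj u v
    & forall c : seq V, ucycle adj c -> (size c <= 2)%N].

(* The cells of the complement of a subgraph: a vertex v is the cell [set v],
   an open edge uv is the cell [set u; v]. *)
Definition open_cells (SV : {set V}) (SE : {set {set V}}) : {set {set V}} :=
  [set [set v] | v in ~: SV] :|: (graph_edges :\: SE).

Definition incident (SV : {set V}) (SE : {set {set V}}) : rel {set V} :=
  fun c c' => [&& c \in open_cells SV SE, c' \in open_cells SV SE
                & (c \proper c') || (c' \proper c)].

Definition component (SV : {set V}) (SE : {set {set V}}) (c : {set V}) :
    {set {set V}} :=
  [set c' in open_cells SV SE | connect (incident SV SE) c c'].

Definition components (SV : {set V}) (SE : {set {set V}}) :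
    {set {set {set V}}} :=
  [set component SV SE c | c in open_cells SV SE].

End Trees.

Record by_tree := BYTree {
  vert : finType;
  adj : rel vert;
  adj_tree : is_tree adj;
  len : {set vert} -> nat;
  len_gt0 : forall e, e \in graph_edges adj -> (0 < len e)%N;
  SV : {set vert};
  SE : {set {set vert}};
  SE_edges : SE \subset graph_edges adj;
  SE_SV : forall e, e \in SE -> e \subset SV;
  (* [eps C] is true when the sign of the component C is -1; values outside
     [components adj SV SE] are irrelevant. *)
  eps : {set {set vert}} -> bool;
  F : {perm vert};
  F_adj : forall u v, adj (F u) (F v) = adj u v;
  F_len : forall e, e \in graph_edges adj -> len (F @: e) = len e;
  F_SV : F @: SV = SV;
  F_SE : [set F @: e | e : {set vert} in SE] = SE
}.

Section BYTreeDefs.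
Variable T : by_tree.

Definition edges : {set {set vert T}} := graph_edges (@adj T).

Definition simple : Prop :=
  [/\ SE T = set0, SV T != set0
    & forall v, v \in SV T -> #|[set u | adj u v]| = 1%N].

Definition positive : Prop :=
  forall C, C \in components (@adj T) (SV T) (SE T) -> eps C = false.

Definition parity_B : Prop :=
  forall (u v : vert T) (k : nat), adj u v ->
    (F T ^+ k)%g u = v -> (F T ^+ k)%g v = u -> ~~ odd (len [set u; v]).

(* A 1-chain is an antisymmetric function on ordered pairs of vertices: its
   value at (u, v) is the coefficient of the edge uv oriented from u to v, the
   oppositely oriented edge being its negative.  As there are no 2-cells,
   H_1(T, S; Z) is the group of chains on the edges not in S whose boundary,
   here [\sum_u a (u, v)] at v, is supported on S. *)
Definition chain := {ffun vert T * vert T -> int}.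

Definition rel_cycle : {pred chain} := fun a : chain =>
  [&& [forall u, forall v, a (v, u) == - a (u, v)],
      [forall u, forall v, (a (u, v) != 0) ==>
         (adj u v && ([set u; v] \notin SE T))]
    & [forall (v | v \notin SV T), \sum_u a (u, v) == 0]].

Lemma rel_cycleP (a : chain) :
  reflect [/\ forall u v, a (v, u) = - a (u, v),
              forall u v, a (u, v) != 0 -> adj u v && ([set u; v] \notin SE T)
            & forall v, v \notin SV T -> \sum_u a (u, v) = 0]
          (a \in rel_cycle).
Proof.
apply: (iffP and3P) => -[h1 h2 h3]; split.
- by move=> u v; apply/eqP; move/forallP/(_ u)/forallP: h1.
- by move=> u v; apply/implyP; move/forallP/(_ u)/forallP: h2.
- by move=> v hv; apply/eqP; move/forallP/(_ v)/implyP: h3; apply.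
- by apply/forallP => u; apply/forallP => v; apply/eqP.
- by apply/forallP => u; apply/forallP => v; apply/implyP; apply: h2.
- by apply/forallP => v; apply/implyP => hv; apply/eqP; apply: h3.
Qed.

Lemma rel_cycle_zmod : zmod_closed rel_cycle.
Proof.
split.
  apply/rel_cycleP; split=> [u v|u v|v _]; rewrite ?ffunE ?oppr0 ?eqxx //.
  by rewrite big1 // => u _; rewrite ffunE.
move=> a b /rel_cycleP[a1 a2 a3] /rel_cycleP[b1 b2 b3].
apply/rel_cycleP; split=> [u v|u v|v hv].
- by rewrite !ffunE a1 b1 opprD.
- rewrite !ffunE => h.
  have [a0|] := eqVneq (a (u, v)) 0; last exact: a2.
  by apply: b2; move: h; rewrite a0 add0r oppr_eq0.
- under eq_bigr do rewrite !ffunE.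
  by rewrite big_split sumrN a3 // b3 // subr0.
Qed.

HB.instance Definition _ :=
  GRing.isZmodClosed.Build chain rel_cycle rel_cycle_zmod.

Record lattice := Lattice { chain_of : chain; _ : chain_of \in rel_cycle }.
HB.instance Definition _ := [isSub for chain_of].
HB.instance Definition _ := [Choice of lattice by <:].
HB.instance Definition _ := [SubChoice_isSubZmodule of lattice by <:].

(* Each edge is counted once, with an arbitrary choice of orientation on which
   the summand does not depend. *)
Definition pairing (a b : chain) : int :=
  \sum_(p : vert T * vert T | (enum_rank p.1 < enum_rank p.2)%N)
     (len [set p.1; p.2])%:Z * a p * b p.

Definition edge_sign (u v : vert T) : int :=
  (-1) ^+ eps (component (@adj T) (SV T) (SE T) [set u; v]).

Definition act_chain (a : chain) : chain :=
  [ffun p => edge_sign ((F T)^-1%g p.1) ((F T)^-1%g p.2)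
               * a ((F T)^-1%g p.1, (F T)^-1%g p.2)].

Definition inv_chain (a : chain) : chain :=
  [ffun p => edge_sign p.1 p.2 * a (F T p.1, F T p.2)].

Lemma edge_signC u v : edge_sign u v = edge_sign v u.
Proof. by rewrite /edge_sign setUC. Qed.

Lemma edge_signK u v : edge_sign u v * edge_sign u v = 1.
Proof. by rewrite -expr2 sqrr_sign. Qed.

Lemma inv_chainK : cancel inv_chain act_chain.
Proof.
move=> a; apply/ffunP => -[u v]; rewrite !ffunE /= mulrA edge_signK mul1r.
by rewrite !permKV.
Qed.

Lemma act_chainK : cancel act_chain inv_chain.
Proof.
by move=> a; apply/ffunP => -[u v]; rewrite !ffunE /= !permK mulrA edge_signK
  mul1r.
Qed.

Lemma F_SVE v : (F T v \in SV T) = (v \in SV T).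
Proof. by rewrite -{1}(F_SV T) mem_imset //; apply: perm_inj. Qed.

Lemma F_SEE u v : ([set F T u; F T v] \in SE T) = ([set u; v] \in SE T).
Proof.
rewrite -[[set u; v] \in _](mem_imset _ _ (imset_inj (@perm_inj _ (F T)))).
by rewrite F_SE imsetU1 imset_set1.
Qed.

Lemma open_edge_sign u v : v \notin SV T ->
  adj u v -> [set u; v] \notin SE T ->
  edge_sign u v = (-1) ^+ eps (component (@adj T) (SV T) (SE T) [set v]).
Proof.
move=> hv huv hS; rewrite /edge_sign.
have [_ irr _ _ _] := adj_tree T.
have huv_open : [set u; v] \in open_cells (@adj T) (SV T) (SE T).
  by rewrite inE [in X in _ || X]inE hS /=; apply/orP; right;
    apply/imsetP; exists (u, v); rewrite ?inE.
have hv_open : [set v] \in open_cells (@adj T) (SV T) (SE T).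
  by rewrite inE; apply/orP; left; apply/imsetP; exists v; rewrite ?inE.
have neq : u != v by apply: contraTneq huv => ->; rewrite irr.
have prop : [set v] \proper [set u; v].
  by rewrite properE sub1set !inE eqxx orbT /= subUset !sub1set !inE
    (negbTE neq).
congr ((-1) ^+ nat_of_bool (eps _)).
have csym : connect_sym (incident (@adj T) (SV T) (SE T)).
  apply: sym_connect_sym => c c'; rewrite /incident.
  by rewrite andbCA orbC.
apply/setP => c; rewrite !inE; congr (_ && _).
apply: same_connect => //; apply: connect1.
by rewrite /incident huv_open hv_open prop orbT.
Qed.

Lemma inv_chain_rel (a : chain) : a \in rel_cycle -> inv_chain a \in rel_cycle.
Proof.
move=> /rel_cycleP[a1 a2 a3]; apply/rel_cycleP; split=> [u v|u v|v hv].
- by rewrite !ffunE /= a1 mulrN edge_signC.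
- rewrite !ffunE /= mulf_eq0 negb_or => /andP[_] /a2.
  by rewrite F_adj F_SEE.
- under eq_bigr do rewrite !ffunE /=.
  pose s := (-1 : int) ^+ eps (component (@adj T) (SV T) (SE T) [set v]).
  transitivity (\sum_u s * a (F T u, F T v)).
    apply: eq_bigr => u _.
    have [->|/a2] := eqVneq (a (F T u, F T v)) 0; first by rewrite !mulr0.
    by rewrite F_adj F_SEE => /andP[h1 h2]; rewrite open_edge_sign.
  rewrite -mulr_sumr; set t := \sum_u _; suff -> : t = 0 by rewrite mulr0.
  by rewrite -[RHS](a3 (F T v)) ?F_SVE // [RHS](reindex_inj (@perm_inj _ (F T))).
Qed.

Lemma act_chain_rel (a : chain) : a \in rel_cycle -> act_chain a \in rel_cycle.
Proof.
move=> /rel_cycleP[a1 a2 a3]; apply/rel_cycleP; split=> [u v|u v|v hv].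
- by rewrite !ffunE /= a1 mulrN edge_signC.
- rewrite !ffunE /= mulf_eq0 negb_or => /andP[_] /a2.
  by rewrite -F_adj -F_SEE !permKV.
- under eq_bigr do rewrite !ffunE /=.
  pose w := (F T)^-1%g v.
  have hw : w \notin SV T by rewrite -F_SVE permKV.
  pose s := (-1 : int) ^+ eps (component (@adj T) (SV T) (SE T) [set w]).
  transitivity (\sum_u s * a ((F T)^-1%g u, w)).
    apply: eq_bigr => u _; rewrite -/w.
    have [->|/a2] := eqVneq (a ((F T)^-1%g u, w)) 0; first by rewrite !mulr0.
    by move=> /andP[h1 h2]; rewrite open_edge_sign.
  rewrite -mulr_sumr; set t := \sum_u _; suff -> : t = 0 by rewrite mulr0.
  by rewrite -[RHS](a3 w) // [RHS](reindex_inj (@perm_inj _ (F T)^-1%g)).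
Qed.

Definition signed_aut (a : lattice) : lattice :=
  Lattice (act_chain_rel (valP a)).

Definition signed_aut_inv (a : lattice) : lattice :=
  Lattice (inv_chain_rel (valP a)).

Lemma signed_autK : cancel signed_aut signed_aut_inv.
Proof. by move=> a; apply/val_inj/act_chainK. Qed.

Lemma signed_aut_invK : cancel signed_aut_inv signed_aut.
Proof. by move=> a; apply/val_inj/inv_chainK. Qed.

Lemma signed_aut_inv_add : {morph signed_aut_inv : a b / a - b}.
Proof.
by move=> a b; apply/val_inj/ffunP => p; rewrite !(ffunE, mulrBr) /=.
Qed.

Lemma pairing_double (a b : lattice) :
  \sum_(p : vert T * vert T) (len [set p.1; p.2])%:Z * chain_of a p * chain_of b p
    = pairing (chain_of a) (chain_of b) *+ 2.
Proof.
have [a1 _ _] := rel_cycleP _ (valP a); have [b1 _ _] := rel_cycleP _ (valP b).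
have diag (u : vert T) : chain_of a (u, u) = 0.
  have /eqP := a1 u u.
  by rewrite -addr_eq0 -mulr2n mulrn_eq0 /= => /eqP.
rewrite (bigID (fun p => (enum_rank p.1 < enum_rank p.2)%N)) /= mulr2n.
congr (_ + _).
rewrite (bigID (fun p : vert T * vert T => p.1 == p.2)) /= big1 ?add0r; last first.
  by move=> [u v] /= /andP[_ /eqP ->]; rewrite diag mulr0 mul0r.
rewrite (reindex_inj (can_inj swap_pairK)) /=; apply: eq_big => [[u v]|[u v] _] /=.
  rewrite -leqNgt andbC eq_sym ltn_neqAle; congr (~~ _ && _).
  by rewrite (inj_eq val_inj) (inj_eq enum_rank_inj).
by rewrite [chain_of a (v, u)]a1 [chain_of b (v, u)]b1 setUC
  !(mulrN, mulNr) opprK.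
Qed.

Lemma pairing_signed_aut (a b : lattice) :
  pairing (chain_of (signed_aut a)) (chain_of (signed_aut b))
    = pairing (chain_of a) (chain_of b).
Proof.
have two : forall x y : int, x *+ 2 = y *+ 2 -> x = y.
  by move=> x y /eqP; rewrite eqrMn2r // => /eqP.
apply: two; rewrite -!pairing_double.
pose f (p : vert T * vert T) := (F T p.1, F T p.2).
have fI : injective f by move=> [u v] [u' v'] [/perm_inj -> /perm_inj ->].
rewrite (reindex_inj fI) /=; apply: eq_bigr => -[u v] _.
rewrite !ffunE /= !permK.
have [_ h _] := rel_cycleP _ (valP a).
have [->|/h /andP[huv _]] := eqVneq (chain_of a (u, v)) 0.
  by rewrite !(mulr0, mul0r).
have -> : len [set F T u; F T v] = len [set u; v].
  rewrite -(@F_len T [set u; v]) ?imsetU1 ?imset_set1 //.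
  by apply/imsetP; exists (u, v); rewrite ?inE.
by rewrite -!mulrA; congr (_ * _);
  rewrite mulrCA [X in _ * X]mulrA edge_signK mul1r.
Qed.

Definition is_hom : {pred lattice -> int} :=
  fun f => `[< {morph f : a b / a - b} >].

Lemma is_hom_zmod : zmod_closed is_hom.
Proof.
split; first by apply/asboolP => a b; rewrite subr0.
move=> f g /asboolP hf /asboolP hg; apply/asboolP => a b.
change (f (a - b) - g (a - b) = (f a - g a) - (f b - g b)).
by rewrite hf hg !opprD !opprK addrACA.
Qed.

HB.instance Definition _ :=
  GRing.isZmodClosed.Build (lattice -> int) is_hom is_hom_zmod.

Record dual := Dual { hom_of :> lattice -> int; _ : hom_of \in is_hom }.
HB.instance Definition _ := [isSub for hom_of].
HB.instance Definition _ := [Choice of dual by <:].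
HB.instance Definition _ := [SubChoice_isSubZmodule of dual by <:].

Lemma dual_act_hom (f : dual) : (f \o signed_aut_inv) \in is_hom.
Proof.
apply/asboolP => a b /=; rewrite signed_aut_inv_add.
by have /asboolP -> := valP f.
Qed.

(* The contragredient action: the embedding of the lattice in its dual is
   equivariant by [pairing_signed_aut]. *)
Definition dual_act (f : dual) : dual := Dual (dual_act_hom f).

(* The image of the lattice in its dual under the pairing. *)
Definition from_lattice : {pred dual} :=
  fun f => `[< exists a : lattice, forall b : lattice,
    f b = pairing (chain_of a) (chain_of b) >].

Lemma from_lattice_zmod : zmod_closed from_lattice.
Proof.
split.
  apply/asboolP; exists 0 => b; rewrite /pairing big1 // => p _.
  by rewrite ffunE mulr0 mul0r.
move=> f g /asboolP[a ha] /asboolP[b hb]; apply/asboolP; exists (a - b) => c.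
change (f c - g c = pairing (chain_of (a - b)) (chain_of c)).
rewrite ha hb /pairing -sumrB; apply: eq_bigr => p _.
by rewrite !ffunE mulrBr mulrBl.
Qed.

HB.instance Definition _ :=
  GRing.isZmodClosed.Build dual from_lattice from_lattice_zmod.

Notation disc_group := (Quotient.quot from_lattice).

Definition disc_act (x : disc_group) : disc_group :=
  \pi_disc_group (dual_act (generic_quotient.repr x)).

(* [disc_act] is the map induced by [dual_act] on the quotient. *)
Lemma disc_act_pi (f : dual) :
  disc_act (\pi_disc_group f) = \pi_disc_group (dual_act f).
Proof.
have h (g : dual) : g \in from_lattice -> dual_act g \in from_lattice.
  move=> /asboolP[a ha]; apply/asboolP; exists (signed_aut a) => b /=.
  by rewrite ha -pairing_signed_aut signed_aut_invK.
apply/eqP; rewrite /disc_act -[_ == _]Quotient.idealrBE.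
have -> : dual_act (generic_quotient.repr (\pi_disc_group f)) - dual_act f
        = dual_act (generic_quotient.repr (\pi_disc_group f) - f) by apply/val_inj.
by apply: h; rewrite Quotient.idealrBE reprK.
Qed.

(* The pairing is positive definite, so the group is finite and the junk value
   of [fset_set] on infinite sets does not occur. *)
Definition tamagawa : nat :=
  #|` fset_set [set x : disc_group | disc_act x = x]%classic|.

Definition vert_orbit (v : vert T) : {set vert T} := orbit 'P <[F T]> v.

Definition edge_orbit (e : {set vert T}) : {set {set vert T}} :=
  orbit ('P^* )%act <[F T]> e.

Definition S_orbits : {set {set vert T}} := [set vert_orbit v | v in SV T].

Definition quot_vert : {set {set vert T}} :=
  [set vert_orbit v | v : vert T].

Definition quot_edges : {set {set {set vert T}}} :=
  [set edge_orbit e | e in edges].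

(* The length does not depend on the edge picked in the orbit, see
   [quot_len_orbit]. *)
Definition quot_len (e' : {set {set vert T}}) : rat :=
  if [pick e in e'] is Some e then (len e)%:R / #|e'|%:R else 0.

Lemma quot_len_orbit e : e \in edges ->
  quot_len (edge_orbit e) = (len e)%:R / #|edge_orbit e|%:R.
Proof.
move=> he; rewrite /quot_len; case: pickP => [e1|/(_ e)]; last first.
  by rewrite /edge_orbit orbit_refl.
move=> /orbitP[g /cycleP[k ->] <-] {e1}; congr (_%:R / _).
suff [] : setact 'P e (F T ^+ k)%g \in edges /\
          len (setact 'P e (F T ^+ k)%g) = len e by [].
have step e1 : setact 'P e1 (F T) = F T @: e1 by [].
elim: k => [|k [IHe IHl]].
  by have /= -> := act1 ('P^* )%act e.
have -> : setact 'P e (F T ^+ k.+1)%g = F T @: setact 'P e (F T ^+ k)%g.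
  by rewrite -step expgSr; apply: (actM ('P^* )%act).
rewrite F_len //; split=> //.
have /imsetP[[u v] huv ->] := IHe.
rewrite imsetU1 imset_set1; apply/imsetP; exists (F T u, F T v) => //.
by move: huv; rewrite !inE /= F_adj.
Qed.

(* Adjacency in the quotient tree after removal of the edges in D.  If an edge
   is inverted by an iterate of F, its image is here a loop (topologically, a
   segment ending at the image of its midpoint); removing it separates no two
   points of the quotient either way. *)
Definition quot_adj (D : {set {set {set vert T}}}) : rel {set vert T} :=
  fun x y => [&& x \in quot_vert, y \in quot_vert
    & [exists u in x, exists v in y,
         adj u v && (edge_orbit [set u; v] \notin D)]].

Definition separates (D : {set {set {set vert T}}}) : bool :=
  [forall x in S_orbits, forall y in S_orbits,
     (x != y) ==> ~~ connect (quot_adj D) x y].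

End BYTreeDefs.

(* Main.v *)
(* The discriminant group A of the lattice is finite, so its F-invariants and its
   F-coinvariants have the same order.  As T is contractible, the dual lattice
   is Z^S modulo constants, so its coinvariants are Z^(S/F) modulo the vector of
   orbit sizes; the coinvariants of A are the quotient of Z^(S/F) by the rows of
   a square integer matrix, whose determinant is counted: it is Q times the
   determinant of the length pairing on the relative homology of T', in the
   basis of paths from one point of S/F to the others.  By the Cauchy-Binet
   formula the latter is a sum over r-tuples D of edges of T' of the product of
   the lengths times the square of a minor, which is 1 if D separates the points
   of S/F and 0 otherwise.  The parity condition enters in showing that the flow
   from w to g w in T has a potential with integral average. *)
From HB Require Import structures.
From mathcomp Require Import mathcomp_extra boolp classical_sets functions cardinality.
From mathcomp Require Import all_boot all_order all_algebra all_fingroup finmap.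
From mathcomp Require Import ring.
Require Import Defs.

Set Implicit Arguments.
Unset Strict Implicit.
Unset Printing Implicit Defensive.

Import Order.TTheory GRing.Theory Num.Theory.

Local Open Scope ring_scope.
Local Open Scope quotient_scope.

(** Taking coinvariants is right exact, so the coinvariants of the discriminant group are presented
    by those of the dual lattice modulo the image of the lattice; invariants have no such
    description. The obstacle is the number of relations: the lattice yields one for every point of
    S, while a square matrix has room for one per orbit. Relations of two points w, g w of one orbit
    differ by that of the path from w to g w. The translates of this path cancel in total, so its
    potential has the same mean on every orbit of vertices; if the mean is an integer, the
    difference is an integral multiple of the vector of orbit sizes. The lengths l(e)/q come from
    averaging paths over the group: on each of the q edges of an orbit the averaged path has the
    coefficient of its image in T' divided by q, so an orbit contributes q l(e) / q^2 to the
    pairing. *)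

(** * Determinants, finite quotients and sums over orbits *)

Lemma cauchy_binet (R : comNzRingType) (I : finType) (E : {set I}) (n : nat)
    (A : 'I_n -> I -> R) (C : I -> 'I_n -> R) (e0 : I) :
  \det (\matrix_(i, j) \sum_(e in E) A i e * C e j) =
  \sum_(D : {set I} | (D \subset E) && (#|D| == n))
     \det (\matrix_(i < n, k < n) A i (nth e0 (enum D) k)) *
     \det (\matrix_(k < n, j < n) C (nth e0 (enum D) k) j).
Proof.
pose dC (f : {ffun 'I_n -> I}) := \det (\matrix_(i, j) C (f i) j).
transitivity (\sum_(f : {ffun 'I_n -> I} | [forall i, f i \in E])
                (\prod_i A i (f i)) * dC f).
  rewrite /determinant.
  transitivity (\sum_(s : 'S_n) \sum_(f : {ffun 'I_n -> I} | [forall i, f i \in E])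
      (-1) ^+ s * (\prod_i (A i (f i) * C (f i) (s i)))).
    apply: eq_bigr => s _; rewrite -big_distrr /=; congr (_ * _).
    under eq_bigr do rewrite mxE.
    rewrite bigA_distr_big; apply: eq_bigl => f.
    by apply/ffun_onP/forallP => fE i; apply: fE.
  rewrite exchange_big /=; apply: eq_bigr => f _.
  rewrite /dC /determinant big_distrr /=; apply: eq_bigr => s _.
  rewrite big_split /= mulrCA; congr (_ * (_ * _)).
  by apply: eq_bigr => i _; rewrite mxE.
(* A non-injective f repeats a row of C. The injective ones are grouped by their image D; they are
   the enumeration of D composed with a permutation. *)
rewrite (bigID (fun f : {ffun 'I_n -> I} => injectiveb f)) /= [X in _ + X]big1 ?addr0;
    last first.
  move=> f /andP[_ /injectivePn[i [j neq_ij eq_f]]].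
  rewrite /dC (determinant_alternate neq_ij) ?mulr0 // => k.
  by rewrite !mxE eq_f.
rewrite (partition_big (fun f : {ffun 'I_n -> I} => f @: 'I_n)
   (fun D : {set I} => (D \subset E) && (#|D| == n))) /=; last first.
  move=> f /andP[/forallP fE /injectiveP f_inj]; apply/andP; split.
    by apply/subsetP => _ /imsetP[i _ ->].
  by rewrite card_imset // card_ord.
apply: eq_bigr => D /andP[/subsetP DE /eqP cD].
pose eD (k : 'I_n) := nth e0 (enum D) k.
have lt_size (k : 'I_n) : (k < size (enum D))%N by rewrite -cardE cD.
have eD_inj : injective eD.
  move=> k l /eqP; rewrite /eD nth_uniq ?enum_uniq ?lt_size //.
  by move/eqP/val_inj.
have eD_in k : eD k \in D by rewrite -mem_enum mem_nth.
pose h (t : 'S_n) : {ffun 'I_n -> I} := [ffun i => eD (t i)].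
have h_inj : injective h.
  move=> t u /ffunP eq_tu; apply/permP => i.
  by have := eq_tu i; rewrite !ffunE => /eD_inj.
transitivity (\sum_(f in [set h t | t in 'S_n]) (\prod_i A i (f i)) * dC f).
  apply: eq_bigl => f; apply/idP/imsetP; last first.
    move=> [t _ ->]; rewrite -andbA; apply/and3P; split.
    - by apply/forallP => i; rewrite ffunE DE.
    - by apply/injectiveP => i j; rewrite !ffunE => /eD_inj/perm_inj.
    - rewrite eqEcard cD card_imset ?card_ord ?leqnn ?andbT; last first.
        by move=> i j; rewrite !ffunE => /eD_inj/perm_inj.
      by apply/subsetP => _ /imsetP[i _ ->]; rewrite ffunE.
  move=> /andP[/andP[_ /injectiveP f_inj] /eqP fD].
  have lt_ind i : (index (f i) (enum D) < n)%N.
    by rewrite -[X in (_ < X)%N]cD cardE index_mem mem_enum -fD imset_f.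
  pose t i := Ordinal (lt_ind i).
  have eDt i : eD (t i) = f i.
    by rewrite /eD nth_index // mem_enum -fD imset_f.
  have t_inj : injective t by move=> i j /(congr1 eD); rewrite !eDt => /f_inj.
  by exists (perm t_inj); rewrite ?inE //; apply/ffunP => i; rewrite ffunE permE eDt.
rewrite big_imset /=; last by move=> t u _ _; apply: h_inj.
rewrite [in RHS]/determinant big_distrl /=; apply: eq_big => [t|t _].
  by rewrite inE.
have -> : dC (h t) = (-1) ^+ t * \det (\matrix_(k < n, j < n) C (eD k) j).
  rewrite -det_perm -det_mulmx -row_permE; congr (\det _).
  by apply/matrixP => i j; rewrite !mxE ffunE.
rewrite mulrA; congr (_ * _); rewrite mulrC; congr (_ * _).
by apply: eq_bigr => i _; rewrite mxE ffunE.
Qed.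

(** The quotient of Z^n by the row span of M is encoded by a labelling [h] whose fibres are the
    cosets. With the Smith form M = L D R, the label of x is x R^-1 reduced modulo the diagonal
    entries of D. *)
Lemma int_mx_index (n : nat) (M : 'M[int]_n) : \det M != 0 ->
  exists (Y : finType) (h : 'rV[int]_n -> Y),
    [/\ #|Y| = `|\det M|%N, forall y, exists x, h x = y
      & forall x y, h x = h y <-> exists z, x - y = z *m M].
Proof.
case: (int_Smith_normal_form M) => L L_unit [R R_unit [d _ ->]].
pose dd := \row_(i < n) (d`_i : int).
have -> : (\matrix_(i < n, j < n) (d`_i *+ (i == j :> nat))) = diag_mx dd.
  by apply/matrixP => i j; rewrite !mxE.
rewrite !det_mulmx det_diag.
have normU (U : 'M[int]_n) : U \in unitmx -> `|\det U|%N = 1%N.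
  move=> /mulmxV/(congr1 (fun V => `|\det V|%N)).
  by rewrite det_mulmx det1 abszM => /eqP; rewrite muln_eq1 => /andP[/eqP].
rewrite !mulf_eq0 !negb_or => /andP[/andP[_ d_neq0] _].
rewrite !abszM !normU // mul1n muln1.
have d_neq0i i : dd ord0 i != 0 by move/prodf_neq0: d_neq0; apply.
have d_gt0 i : (0 < `|dd ord0 i|)%N by rewrite absz_gt0.
pose Y := {dffun forall i : 'I_n, 'I_`|dd ord0 i|}.
have modlt (z : int) i : (`|(z %% dd ord0 i)%Z| < `|dd ord0 i|)%N.
  by rewrite -ltz_nat gez0_abs ?modz_ge0 // abszE ltz_mod.
pose h (x : 'rV[int]_n) : Y :=
  [ffun i => Ordinal (modlt ((x *m invmx R) ord0 i) i)].
exists Y, h; split.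
- rewrite card_dep_ffun foldrE big_map big_enum /=.
  rewrite (big_morph absz abszM (erefl `|1|%N)).
  by apply: eq_bigr => i _; rewrite card_ord.
- move=> y; exists ((\row_i (y i : nat)%:Z) *m R).
  apply/ffunP => i; apply/val_inj; rewrite ffunE /= mulmxK // mxE.
  by rewrite -modz_abs modz_small ?ltz_nat ?ltn_ord.
- move=> x y.
  have subE i : ((x - y) *m invmx R) ord0 i =
      (x *m invmx R) ord0 i - (y *m invmx R) ord0 i by rewrite mulmxBl !mxE.
  split.
    move=> /ffunP eq_h.
    have dvd i : (dd ord0 i %| ((x - y) *m invmx R) ord0 i)%Z.
      have := congr1 val (eq_h i); rewrite !ffunE subE /= => eq_mod.
      rewrite -eqz_mod_dvd -[X in X == _]gez0_abs ?modz_ge0 // eq_mod.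
      by rewrite gez0_abs ?modz_ge0.
    pose z := \row_i (((x - y) *m invmx R) ord0 i %/ dd ord0 i)%Z.
    exists (z *m invmx L); rewrite !mulmxA mulmxKV //.
    rewrite -[LHS](mulmxKV R_unit); congr (_ *m R).
    by apply/rowP => i; rewrite mul_mx_diag mxE [z _ _]mxE divzK // (ord1 0).
  move=> [z eq_z]; apply/ffunP => i; apply/val_inj; rewrite !ffunE /=.
  congr (`|_|%N); apply/eqP; rewrite eqz_mod_dvd.
  by rewrite -subE eq_z !mulmxA mulmxK // mul_mx_diag mxE dvdz_mull.
Qed.

(** The kernel and the cokernel, here labelled by [Y], both have order #|A| divided by the order of
    the image. *)
Lemma card_ker_coker (A : finZmodType) (f : {additive A -> A}) (Y : finType)
    (h : A -> Y) :
  (forall y, exists x, h x = y) ->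
  (forall x y, h x = h y <-> exists z, x - y = f z) ->
  #|[set x | f x == 0]| = #|Y|.
Proof.
move=> h_surj hP; pose Im := [set f x | x in A].
have cIm : (0 < #|Im|)%N by apply/card_gt0P; exists (f 0); rewrite imset_f.
apply/eqP; rewrite -(eqn_pmul2r cIm); apply/eqP.
transitivity #|A|.
  apply/esym; rewrite -[LHS]sum1_card (partition_big f (fun y => y \in Im)) /=; last first.
    by move=> x _; rewrite imset_f.
  rewrite [RHS]mulnC -sum_nat_const; apply: eq_bigr => _ /imsetP[x _ ->].
  rewrite sum1dep_card -[RHS](card_imset _ (addrI x)); apply: eq_card => z.
  rewrite !inE; apply/eqP/imsetP => [fz|[u]]; last first.
    by rewrite inE => /eqP fu ->; rewrite raddfD /= fu addr0.
  by exists (z - x); rewrite ?inE ?raddfB /= ?fz ?subrr // addrC subrK.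
rewrite -[LHS]sum1_card (partition_big h predT) //=.
rewrite -sum_nat_const; apply: eq_bigr => y _.
have [x <-] := h_surj y.
rewrite sum1dep_card -[RHS](card_imset _ (addrI x)); apply: eq_card => z.
rewrite !inE; apply/eqP/imsetP => [/hP[u eq_u]|[_ /imsetP[u _ ->] ->]].
  by exists (f u); rewrite ?imset_f // -eq_u addrC subrK.
by apply/hP; exists u; rewrite addrC addKr.
Qed.

Lemma det_row1 (R : comNzRingType) n (N : 'M[R]_n.+1) :
  (forall j, N ord0 j = 1) ->
  \det N = \det (\matrix_(i < n, j < n)
                   (N (lift ord0 i) (lift ord0 j) - N (lift ord0 i) ord0)).
Proof.
move=> N0; pose N' : 'M[R]_(1 + n) := N.
(* Multiplication by [U] on the right subtracts column 0 from all others and so clears the row of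
   ones. *)
pose U : 'M[R]_(1 + n) := block_mx 1 (const_mx (-1)) 0 1%:M.
have detU : \det U = 1 by rewrite det_ublock !det1 mulr1.
have ul : ulsubmx N' = 1.
  apply/matrixP => i j; rewrite !mxE !ord1 eqxx -[RHS](N0 ord0).
  by congr (N _ _); apply: val_inj.
have ur : ursubmx N' = const_mx 1.
  apply/matrixP => i j; rewrite !mxE !ord1 -[RHS](N0 (rshift 1 j)).
  by congr (N _ _); apply: val_inj.
have -> : \det N = \det (N' *m U) by rewrite det_mulmx detU mulr1.
rewrite -[N']submxK mulmx_block ul ur !mulmx1 !mulmx0 !addr0 mul1mx.
have -> : const_mx (-1) + const_mx 1 = 0 :> 'M[R]_(1, n).
  by apply/matrixP => i j; rewrite !mxE addNr.
rewrite det_lblock det1 mul1r; congr (\det _); apply/matrixP => i j.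
rewrite !mxE big_ord1 !mxE mulrN1 addrC.
by congr (N _ _ - N _ _); apply: val_inj.
Qed.

Lemma big_nth_enum (R : Type) (idx : R) (op : Monoid.com_law idx) (I : finType)
    (D : {set I}) (x0 : I) (n : nat) (f : I -> R) : #|D| = n ->
  \big[op/idx]_(e in D) f e = \big[op/idx]_(k < n) f (nth x0 (enum D) k).
Proof. by move=> cD; rewrite -big_enum /= (big_nth x0) big_mkord -cardE cD. Qed.

Lemma mulr2n_int_inj (x y : int) : x *+ 2 = y *+ 2 -> x = y.
Proof. by move/eqP; rewrite eqrMn2r // => /eqP. Qed.

(** The elements carrying x to a given point of its orbit form a coset of the stabiliser. *)
Lemma sum_orbit (gT : finGroupType) (rT : finType) (to : {action gT &-> rT})
    (G : {group gT}) (x : rT) (R : nmodType) (f : rT -> R) :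
  \sum_(g in G) f (to x g) =
  (\sum_(y in orbit to G x) f y) *+ #|('C_G[x | to])%g|.
Proof.
rewrite (partition_big (to x) (mem (orbit to G x))) /=; last first.
  by move=> g gG; apply: mem_orbit.
rewrite -sumrMnl; apply: eq_bigr => _ /orbitP[g gG <-].
transitivity (\sum_(h in amove to G x (to x g)) f (to x g)).
  by apply: eq_big => [h|h /andP[_ /eqP->] //]; rewrite inE.
by rewrite amove_act ?subsetT // sumr_const card_rcoset.
Qed.

(** Here [A] is finite only as a classical set; its enumeration supplies the [finZmodType] structure
    to which [card_ker_coker] applies. *)
Lemma card_fix_finite_quotient (A : zmodType) (f : {additive A -> A}) (Y : finType)
    (h : A -> Y) : finite_set [set: A]%classic ->
  (forall y, exists x, h x = y) ->
  (forall x y, h x = h y <-> exists z, x - y = f z) ->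
  #|` fset_set [set x : A | f x = 0]%classic| = #|Y|.
Proof.
move=> finA h_surj hP.
pose E := enum_fset (fset_set [set: A]%classic).
have EE (x : A) : x \in E by rewrite in_fset_set // in_setE.
have axE : Finite.axiom E.
  by move=> x; rewrite count_uniq_mem ?fset_uniq // EE.
have cK : pcancel (fun x : A => index x E)
    (fun k => if (k < size E)%N then Some (nth 0 E k) else None).
  by move=> x; rewrite index_mem EE nth_index.
pose cA := isCountable.Build A cK.
pose fA := isFinite.Build A axE.
pose A' : finZmodType := HB.pack A cA fA.
have /= <- := @card_ker_coker A' f Y h h_surj hP.
have fixE (x : A) : (x \in fset_set [set x : A | f x = 0]%classic) = (f x == 0).
  rewrite in_fset_set; last by apply: sub_finite_set finA.
  by apply/idP/eqP; rewrite in_setE.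
rewrite cardE; apply/perm_size/(@uniq_perm A) => [||x].
- exact: fset_uniq.
- exact: (@enum_uniq A').
rewrite fixE; apply: esym; rewrite -[RHS](@in_set A' (fun x => f x == 0)).
exact: (@mem_enum A').
Qed.

(** * Chains on a tree *)

Section TreeChains.

Variables (V : finType) (adj : rel V).
Hypothesis tree : is_tree adj.

Implicit Types (a b : {ffun V * V -> int}) (u v w : V).

Definition edge_chain a : Prop :=
  (forall u v, a (v, u) = - a (u, v)) /\ (forall u v, a (u, v) != 0 -> adj u v).

Definition boundary a v : int := \sum_u a (u, v).

Lemma edge_chainB a b : edge_chain a -> edge_chain b -> edge_chain (a - b).
Proof.
move=> [a1 a2] [b1 b2]; split=> u v; rewrite !ffunE.
  by rewrite a1 b1 opprD.
have [a0|/a2 //] := eqVneq (a (u, v)) 0.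
by rewrite a0 add0r oppr_eq0 => /b2.
Qed.

Lemma boundaryB a b v : boundary (a - b) v = boundary a v - boundary b v.
Proof.
by rewrite /boundary -sumrB; apply: eq_bigr => u _; rewrite !ffunE.
Qed.

(* In the support of a nonzero cycle every simple path extends at its head:
   the cycle leaves the head by another edge, and returning to the path would
   close a circuit. *)
Lemma edge_chain_eq0 a : edge_chain a -> (forall v, boundary a v = 0) -> a = 0.
Proof.
move=> [a1 a2] a3; apply/ffunP => -[u0 v0]; rewrite ffunE; apply/eqP.
apply: contraT => a_neq0; have [_ irr _ _ no_cycle] := tree.
pose e : rel V := fun u v => a (u, v) != 0.
have e_adj u v : e u v -> adj u v by apply: a2.
suff long k : exists x y p, [/\ path e x (y :: p), uniq (x :: y :: p) & size p = k].
  have [x [y [p [_ up sp]]]] := long #|V|.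
  have := max_card (mem (x :: y :: p)).
  by rewrite (card_uniqP up) /= sp ltnNge leqnSn.
elim: k => [|k [x [y [p [ep up sp]]]]].
  exists u0, v0, [::]; rewrite /= andbT; split=> //.
  by rewrite inE andbT; apply: contraTneq (e_adj _ _ a_neq0) => ->; rewrite irr.
have exy : e x y by case/andP: ep.
have [w ewx neq_wy] : exists2 w, e w x & w != y.
  apply/exists_inP; apply: contraTT exy; rewrite negb_exists_in => /forall_inP none.
  rewrite /e negbK; have := a3 x; rewrite /boundary (bigD1 y) //= big1 ?addr0.
    by move=> ayx; rewrite a1 ayx oppr0.
  by move=> w neq_wy; apply/eqP; apply: contraT => /none; rewrite neq_wy.
have [w_in|w_notin] := boolP (w \in x :: y :: p); last first.
  by exists w, x, (y :: p); split=> //=; [apply/andP | rewrite w_notin | rewrite sp].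
have neq_wx : w != x by apply: contraTneq (e_adj _ _ ewx) => ->; rewrite irr.
move: w_in; rewrite !inE (negbTE neq_wx) (negbTE neq_wy) /= => w_in.
case/splitPr: w_in ep up {sp} => p1 p2 ep up.
suff ucyc : ucycle adj [:: x, y & rcons p1 w].
  by have := no_cycle _ ucyc; rewrite /= size_rcons.
apply/andP; split.
  rewrite /= in ep; case/andP: ep => _; rewrite cat_path /= => /and3P[ep1 ep1w _].
  rewrite rcons_path last_rcons (e_adj _ _ ewx) (e_adj _ _ exy) andbT /=.
  by rewrite rcons_path (sub_path e_adj) ?e_adj.
move: up; rewrite -cat_rcons -!cat_cons cat_uniq => /andP[]; exact.
Qed.

Definition arc u v : {ffun V * V -> int} :=
  [ffun p => (p == (u, v))%:Z - (p == (v, u))%:Z].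

Lemma edge_chain_arc u v : adj u v -> edge_chain (arc u v).
Proof.
have [sym _ _ _ _] := tree => uv; split=> x y; rewrite !ffunE.
  by rewrite opprB !xpair_eqE ![(y == _) && _]andbC.
rewrite !xpair_eqE; have [/andP[/eqP-> /eqP->] //|_] := boolP ((x == u) && (y == v)).
by have [/andP[/eqP-> /eqP->] _|//] := boolP ((x == v) && (y == u)); rewrite sym.
Qed.

Lemma boundary_arc u v w : boundary (arc u v) w = (w == v)%:Z - (w == u)%:Z.
Proof.
rewrite /boundary; under eq_bigr do rewrite ffunE !xpair_eqE.
rewrite sumrB (bigD1 u) //= eqxx /= big1 ?addr0 => [|x /negbTE-> //].
by rewrite (bigD1 v) //= eqxx /= big1 ?addr0 => [|x /negbTE-> //].
Qed.

Lemma exists_path_chain u v : exists a, edge_chain a /\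
  (forall w, boundary a w = (w == v)%:Z - (w == u)%:Z).
Proof.
have [_ _ _ conn _] := tree.
have /connectP[p up ->] := conn u v; elim: p u up => [|x p IHp] u /=.
  move=> _; exists 0; split; first by split=> x y; rewrite !ffunE ?oppr0 ?eqxx.
  by move=> w; rewrite subrr /boundary big1 // => x _; rewrite ffunE.
move=> /andP[ux /IHp[a [ac ab]]].
exists (a - arc x u); split.
  by apply: edge_chainB => //; apply: edge_chain_arc; have [->] := tree.
by move=> w; rewrite boundaryB ab boundary_arc opprB addrA subrK.
Qed.

(** The choice is harmless: by [edge_chain_inj] the boundary determines the chain, and identities
    between paths are proved by comparing boundaries. *)
Definition path_chain u v := projT1 (cid (exists_path_chain u v)).

Lemma edge_chain_path u v : edge_chain (path_chain u v).
Proof. by rewrite /path_chain; case: cid => ? []. Qed.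

Lemma boundary_path u v w :
  boundary (path_chain u v) w = (w == v)%:Z - (w == u)%:Z.
Proof. by rewrite /path_chain; case: cid => ? []. Qed.

Lemma path_chainC u v p : path_chain u v (p.2, p.1) = - path_chain u v p.
Proof. by case: p => x y; case: (edge_chain_path u v). Qed.

Lemma path_chain_adj u v p : path_chain u v p != 0 -> adj p.1 p.2.
Proof. by case: p => x y; case: (edge_chain_path u v) => _; apply. Qed.

Lemma edge_chain_inj a b : edge_chain a -> edge_chain b ->
  (forall v, boundary a v = boundary b v) -> a = b.
Proof.
move=> ac bc ab; apply/eqP; rewrite -subr_eq0; apply/eqP/edge_chain_eq0.
  exact: edge_chainB.
by move=> v; rewrite boundaryB ab subrr.
Qed.

Lemma path_chainB s u v : path_chain s v - path_chain s u = path_chain u v.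
Proof.
apply: edge_chain_inj => [||w]; last first.
  by rewrite boundaryB !boundary_path opprB addrA subrK.
- exact: edge_chain_path.
- by apply: edge_chainB; apply: edge_chain_path.
Qed.

Lemma path_chain_nil u : path_chain u u = 0.
Proof. by rewrite -(path_chainB u) subrr. Qed.

Lemma path_chain_arc u v : adj u v -> path_chain u v = arc u v.
Proof.
move=> uv; apply: edge_chain_inj; [exact: edge_chain_path|exact: edge_chain_arc|].
by move=> w; rewrite boundary_path boundary_arc.
Qed.

Lemma path_chain_aut (g : {perm V}) u v x y :
  (forall x y, adj (g x) (g y) = adj x y) ->
  path_chain (g u) (g v) (g x, g y) = path_chain u v (x, y).
Proof.
move=> g_adj; have := edge_chain_path (g u) (g v).
pose a := path_chain (g u) (g v); rewrite -/a => -[a1 a2].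
suff <- : [ffun p => a (g p.1, g p.2)] = path_chain u v by rewrite ffunE.
apply: edge_chain_inj; [split|exact: edge_chain_path|].
- by move=> x' y'; rewrite !ffunE /= a1.
- by move=> x' y'; rewrite ffunE => /a2; rewrite g_adj.
move=> w; transitivity (boundary a (g w)); last first.
  by rewrite !boundary_path !(inj_eq perm_inj).
rewrite /boundary [RHS](reindex_inj (@perm_inj _ g)).
by apply: eq_bigr => x' _; rewrite ffunE.
Qed.

(** Summation by parts; the factor 2 counts every edge in both orientations. *)
Lemma sum_coboundary a (chi : V -> int) : edge_chain a ->
  \sum_p a p * (chi p.2 - chi p.1) = (\sum_v chi v * boundary a v) *+ 2.
Proof.
move=> [a1 _].
have sum2 : \sum_p a p * chi p.2 = \sum_v chi v * boundary a v.
  transitivity (\sum_u \sum_v a (u, v) * chi v).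
    by rewrite pair_bigA; apply: eq_bigr => -[].
  rewrite exchange_big /=.
  apply: eq_bigr => v _; rewrite mulr_sumr.
  by apply: eq_bigr => u _; rewrite mulrC.
under eq_bigr do rewrite mulrBr; rewrite sumrB sum2 mulr2n; congr (_ + _).
rewrite -sum2 (reindex_inj (can_inj swap_pairK)) -sumrN /=.
by apply: eq_bigr => -[u v] _ /=; rewrite [a (swap_pair _)]a1 mulNr opprK.
Qed.

(* Lefschetz fixed point formula: with e the arc from u to v, the sum over all
   arcs of the coefficient of e in its image computes twice the trace on edges,
   and it equals twice the number of fixed vertices minus 1. *)
Lemma aut_fix_or_flip (g : {perm V}) :
  (forall x y, adj (g x) (g y) = adj x y) ->
  (exists v, g v = v) \/ (exists2 v, adj v (g v) & g (g v) = v).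
Proof.
move=> g_adj; have [_ irr /card_gt0P[s _] _ _] := tree.
have [/existsP[v /eqP]|/existsPn nofix] := boolP [exists v, g v == v].
  by left; exists v.
right.
pose X := \sum_(p : V * V) path_chain s (g p.2) p.
have X_eq : X = -1.
  transitivity (\sum_u \sum_v path_chain s (g v) (u, v)).
    by rewrite pair_bigA; apply: eq_bigr => -[].
  rewrite exchange_big /=.
  transitivity (\sum_v ((v == g v)%:Z - (v == s)%:Z)).
    by apply: eq_bigr => v _; rewrite -boundary_path.
  rewrite sumrB big1 => [|v _]; last by rewrite eq_sym (negbTE (nofix v)).
  by rewrite add0r (bigD1 s) //= eqxx big1 ?addr0 // => v /negbTE->.
have X2 : X *+ 2 = \sum_(p : V * V) path_chain (g p.1) (g p.2) p.
  transitivity (\sum_(p : V * V) (path_chain s (g p.2) p - path_chain s (g p.1) p)).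
    rewrite sumrB mulr2n; congr (_ + _).
    rewrite /X (reindex_inj (can_inj swap_pairK)) -sumrN /=.
    by apply: eq_bigr => -[u v] _; exact: (path_chainC _ _ (u, v)).
  by apply: eq_bigr => p _; rewrite -(path_chainB s (g p.1)) !ffunE.
(* Since X is not 0, some arc occurs in its own image, which is a single arc; as no vertex is fixed,
   it occurs reversed. *)
have [[u v] puv|none] := pickP (fun p : V * V => path_chain (g p.1) (g p.2) p != 0);
    last first.
  by move: X2; rewrite X_eq big1 // => p _; apply/eqP; have /negbT := none p; rewrite negbK.
rewrite /= in puv; have uv := path_chain_adj puv; rewrite /= in uv.
move: puv; rewrite path_chain_arc ?g_adj // ffunE !xpair_eqE.
rewrite [u == g u]eq_sym (negbTE (nofix u)) /= => h.
have /andP[/eqP gv /eqP gu] : (u == g v) && (v == g u) by case: andP h.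
by exists u; rewrite -gu.
Qed.

End TreeChains.

(** * The discriminant group of a BY tree *)

Section BYTree.

Variable T : by_tree.
Local Notation V := (vert T).
Local Notation tree := (adj_tree T).
Local Notation G := <[F T]>%g.

Lemma cycle_ind (P : {perm V} -> Prop) :
  P 1%g -> (forall g, P g -> P (g * F T)%g) -> forall g, g \in G -> P g.
Proof.
by move=> P1 PF g /cycleP[k ->]; elim: k => // k IHk; rewrite expgSr; apply: PF.
Qed.

Lemma aut_adj g u v : g \in G -> adj (g u) (g v) = @adj T u v.
Proof.
move=> gG; move: g gG u v.
by apply: cycle_ind => [u v|g IHg u v]; rewrite ?perm1 // !permM F_adj.
Qed.

Lemma aut_len g u v : g \in G -> @adj T u v ->
  len [set g u; g v] = @len T [set u; v].
Proof.
move=> gG uv; suff [] : adj (g u) (g v) /\ len [set g u; g v] = @len T [set u; v] by [].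
move: g gG; apply: cycle_ind => [|g [guv <-]]; first by rewrite !perm1.
rewrite !permM F_adj; split=> //; rewrite -[RHS]F_len ?imsetU1 ?imset_set1 //.
by apply/imsetP; exists (g u, g v); rewrite ?inE.
Qed.

Lemma aut_SV g v : g \in G -> (g v \in SV T) = (v \in SV T).
Proof.
move=> gG; move: g gG v.
by apply: cycle_ind => [v|g IHg v]; rewrite ?perm1 // permM F_SVE.
Qed.

(** * The length pairing on chains *)

(** Twice the pairing on edge chains, but free of any chosen orientation, which allows reindexing by
    automorphisms. *)
Definition energy (a b : chain T) : int :=
  \sum_(p : V * V) (len [set p.1; p.2])%:Z * a p * b p.

Lemma pairing_mulr2n (a b : chain T) :
  edge_chain (@adj T) a -> edge_chain (@adj T) b -> pairing a b *+ 2 = energy a b.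
Proof.
move=> [a1 a2] [b1 _]; apply: esym.
have [_ irr _ _ _] := tree.
rewrite /energy (bigID (fun p => (enum_rank p.1 < enum_rank p.2)%N)) mulr2n /=.
congr (_ + _); rewrite (reindex_inj (can_inj swap_pairK)) /=.
rewrite (bigID (fun p : V * V => p.1 == p.2)) /= big1 ?add0r; last first.
  move=> [u v] /= /andP[_ /eqP ->].
  have [->|/a2] := eqVneq (a (v, v)) 0; last by rewrite irr.
  by rewrite mulr0 mul0r.
apply: eq_big => [[u v]|[u v] _] /=.
  by rewrite -leqNgt andbC ltn_neqAle (inj_eq val_inj) (inj_eq enum_rank_inj).
by rewrite [a _]a1 [b _]b1 setUC !(mulrN, mulNr) opprK.
Qed.

Lemma pairingBr (a b c : chain T) : pairing a (b - c) = pairing a b - pairing a c.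
Proof.
by rewrite /pairing -sumrB; apply: eq_bigr => p _; rewrite !ffunE mulrBr.
Qed.

Lemma pairingBl (a b c : chain T) : pairing (a - b) c = pairing a c - pairing b c.
Proof.
by rewrite /pairing -sumrB; apply: eq_bigr => p _; rewrite !ffunE mulrBr mulrBl.
Qed.

Lemma pairing_arc (a : chain T) u v : edge_chain (@adj T) a -> adj u v ->
  pairing a (arc u v) = (len [set u; v])%:Z * a (u, v).
Proof.
move=> ac uv; have [a1 _] := ac; apply: mulr2n_int_inj.
rewrite pairing_mulr2n //; last by apply: (edge_chain_arc tree).
rewrite /energy; under eq_bigr do rewrite ffunE mulrBr; rewrite sumrB.
rewrite (bigD1 (u, v)) //= eqxx big1 ?addr0 => [|p /negbTE->]; rewrite ?mulr0 //.
rewrite (bigD1 (v, u)) //= eqxx big1 ?addr0 => [|p /negbTE->]; rewrite ?mulr0 //.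
by rewrite !mulr1 [[set v; u]]setUC [a (v, u)]a1 mulrN opprK mulr2n.
Qed.

Lemma energy_eq0 (a : chain T) : edge_chain (@adj T) a -> energy a a = 0 -> a = 0.
Proof.
move=> [_ a2] /eqP; rewrite psumr_eq0; last first.
  by move=> p _; rewrite -mulrA mulr_ge0 // -expr2 sqr_ge0.
move=> /allP a_eq0; apply/ffunP => -[u v]; rewrite ffunE; apply/eqP.
apply: contraT => auv; have := a_eq0 (u, v); rewrite mem_index_enum => /(_ isT) /=.
rewrite !mulf_eq0 (negbTE auv) !orbF eqz_nat => /eqP l0.
suff : (0 < @len T [set u; v])%N by rewrite l0.
by apply: len_gt0; apply/imsetP; exists (u, v); rewrite ?inE ?a2.
Qed.

(** * The lattice and its dual *)

Definition lattice_boundary (v : V) (a : lattice T) : int := boundary (val a) v.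

Lemma lattice_boundary_zmod v : zmod_morphism (lattice_boundary v).
Proof. by move=> a c; rewrite /lattice_boundary raddfB boundaryB. Qed.

HB.instance Definition _ v := GRing.isZmodMorphism.Build (lattice T) int
  (lattice_boundary v) (lattice_boundary_zmod v).

Hypothesis SE0 : SE T = set0.
Variable s0 : V.
Hypothesis s0S : s0 \in SV T.

Local Notation b := (path_chain tree s0).

Lemma path_chain_rel u v : u \in SV T -> v \in SV T ->
  path_chain tree u v \in @rel_cycle T.
Proof.
move=> uS vS; have [a1 a2] := edge_chain_path tree u v; apply/rel_cycleP; split=> //.
  by move=> x y /a2 ->; rewrite SE0 inE.
move=> w wS; rewrite -/(boundary _ w) boundary_path.
by rewrite !(negbTE (contraNneq _ wS)) // => ->.
Qed.

(** The chain [b v] is a relative cycle only for v in S; elsewhere the value is the default 0. *)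
Definition base_path v : lattice T := insubd 0 (b v).

Lemma base_pathE v : v \in SV T -> val (base_path v) = b v.
Proof. by move=> vS; rewrite insubdK // path_chain_rel. Qed.

Lemma base_path0 : base_path s0 = 0.
Proof. by apply: val_inj; rewrite base_pathE // path_chain_nil. Qed.

Lemma edge_chain_lattice (a : lattice T) : edge_chain (@adj T) (val a).
Proof.
have [a1 a2 _] := rel_cycleP _ (valP a); split=> // u v /a2.
by case/andP.
Qed.

Lemma lattice_boundary_out v a : v \notin SV T -> lattice_boundary v a = 0.
Proof. by have [_ _ a3] := rel_cycleP _ (valP a); apply: a3. Qed.

Lemma lattice_boundary_path v s : s \in SV T ->
  lattice_boundary v (base_path s) = (v == s)%:Z - (v == s0)%:Z.
Proof. by move=> sS; rewrite /lattice_boundary base_pathE // boundary_path. Qed.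

Lemma sum_lattice_boundary a : \sum_(s in SV T) lattice_boundary s a = 0.
Proof.
have := sum_coboundary (fun _ => 1) (edge_chain_lattice a).
rewrite big1 => [|p _]; last by rewrite subrr mulr0.
move=> /esym/eqP; rewrite mulrn_eq0 /= => /eqP sum0; rewrite -[RHS]sum0.
rewrite [RHS](bigID (mem (SV T))) /= [X in _ + X]big1 ?addr0.
  by apply: eq_bigr => s _; rewrite mul1r.
by move=> s sS; rewrite mul1r [LHS]lattice_boundary_out.
Qed.

Lemma lattice_inj (a c : lattice T) :
  (forall s, s \in SV T -> lattice_boundary s a = lattice_boundary s c) -> a = c.
Proof.
move=> ac; apply/val_inj/(edge_chain_inj tree); try exact: edge_chain_lattice.
move=> v; have [/ac //|vS] := boolP (v \in SV T).
by have := lattice_boundary_out a vS; rewrite -(lattice_boundary_out c vS).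
Qed.

(** The paths from [s0] to the other points of S form a basis with the boundary values as
    coordinates. The term at [s0] is 0, so the sum may run over all of S. *)
Lemma lattice_decomp (a : lattice T) :
  a = \sum_(s in SV T) base_path s *~ lattice_boundary s a.
Proof.
apply: lattice_inj => v vS; rewrite raddf_sum /=.
rewrite (eq_bigr (fun s => (v == s)%:Z * lattice_boundary s a
                         - (v == s0)%:Z * lattice_boundary s a)); last first.
  move=> s sS; rewrite raddfMz /= lattice_boundary_path //.
  by rewrite mulrzz mulrBl.
rewrite sumrB -mulr_sumr sum_lattice_boundary mulr0 subr0.
rewrite (bigD1 v) //= eqxx mul1r big1 ?addr0 ?subrr // => s /andP[_ /negbTE].
by rewrite eq_sym => ->; rewrite mul0r.
Qed.

HB.instance Definition _ (f : dual T) := GRing.isZmodMorphism.Build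
  (lattice T) int (hom_of f) (elimT (asboolP _) (valP f)).

Definition dual_eval (a : lattice T) (f : dual T) : int := f a.

Lemma dual_eval_zmod a : zmod_morphism (dual_eval a).
Proof. by []. Qed.

HB.instance Definition _ a := GRing.isZmodMorphism.Build (dual T) int
  (dual_eval a) (dual_eval_zmod a).

Lemma dualMz (f : dual T) n a : (f *~ n) a = f a *~ n.
Proof. exact: (raddfMz (dual_eval a)). Qed.

Lemma dual_sum (I : Type) (s : seq I) (P : pred I) (f : I -> dual T) a :
  (\sum_(i <- s | P i) f i) a = \sum_(i <- s | P i) f i a.
Proof. exact: (raddf_sum (dual_eval a)). Qed.

Lemma lattice_boundary_hom v : lattice_boundary v \in @is_hom T.
Proof. by apply/asboolP => a c; rewrite lattice_boundary_zmod. Qed.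

(** For v in S, the class of the basis vector at v in Z^S modulo constants; [sum_dual_boundary] is
    the relation imposed by the constants. *)
Definition dual_boundary v : dual T := Dual (lattice_boundary_hom v).

Lemma pairing_hom (a : lattice T) :
  (fun c : lattice T => pairing (chain_of a) (chain_of c)) \in @is_hom T.
Proof. by apply/asboolP => c d; rewrite -pairingBr. Qed.

Definition pairing_dual (a : lattice T) : dual T := Dual (pairing_hom a).

Lemma pairing_dual_lattice a : pairing_dual a \in @from_lattice T.
Proof. by apply/asboolP; exists a. Qed.

Lemma pairing_dual_zmod : zmod_morphism pairing_dual.
Proof.
by move=> a c; apply/val_inj/funext => d /=; rewrite [LHS]pairingBl.
Qed.

HB.instance Definition _ := GRing.isZmodMorphism.Build (lattice T) (dual T)
  pairing_dual pairing_dual_zmod.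

Lemma dual_act_zmod : zmod_morphism (@dual_act T).
Proof. by move=> f g; apply: val_inj. Qed.

HB.instance Definition _ := GRing.isZmodMorphism.Build (dual T) (dual T)
  (@dual_act T) dual_act_zmod.

Lemma dual_inj (f g : dual T) :
  (forall s, s \in SV T -> f (base_path s) = g (base_path s)) -> f = g.
Proof.
move=> fg; apply/val_inj/funext => a /=; rewrite (lattice_decomp a) !raddf_sum.
by apply: eq_bigr => s sS; rewrite !raddfMz /= fg.
Qed.

Lemma dual_decomp (f : dual T) :
  f = \sum_(s in SV T) dual_boundary s *~ f (base_path s).
Proof.
apply/val_inj/funext => a; rewrite [RHS](raddf_sum (dual_eval a)) /=.
rewrite [in LHS](lattice_decomp a) raddf_sum; apply: eq_bigr => s _.
by rewrite !raddfMz /= !mulrzz mulrC.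
Qed.

Lemma sum_dual_boundary : \sum_(s in SV T) dual_boundary s = 0.
Proof.
apply/val_inj/funext => a; rewrite [LHS](raddf_sum (dual_eval a)).
exact: sum_lattice_boundary.
Qed.

(** * The action of F on the dual lattice *)

Hypothesis positiveT : positive T.

Lemma positive_edge_sign u v : adj u v -> @edge_sign T u v = 1.
Proof.
move=> uv; rewrite /edge_sign positiveT //; apply/imsetP.
exists [set u; v] => //; rewrite inE SE0 setD0; apply/orP; right.
by apply/imsetP; exists (u, v); rewrite ?inE.
Qed.

Lemma dual_act_boundary v : dual_act (dual_boundary v) = dual_boundary (F T v).
Proof.
apply/val_inj/funext => a /=.
rewrite /lattice_boundary /boundary [RHS](reindex_inj (@perm_inj _ (F T))).
apply: eq_bigr => u _; rewrite ffunE /=.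
have [_ a2] := edge_chain_lattice a.
have [->|/a2] := eqVneq (chain_of a (F T u, F T v)) 0; first by rewrite mulr0.
by rewrite F_adj => /positive_edge_sign ->; rewrite mul1r.
Qed.

(* The preimage in the dual lattice of the subgroup [(F - 1) A] of the
   discriminant group [A]. *)
Definition coboundaries : {pred dual T} := fun f =>
  `[< exists e g, e \in @from_lattice T /\ f = e + (dual_act g - g) >].

Lemma coboundaries_zmod : zmod_closed coboundaries.
Proof.
split; first by apply/asboolP; exists 0, 0; rewrite rpred0 raddf0 subrr addr0.
move=> _ _ /asboolP[e [g [eL ->]]] /asboolP[e' [g' [eL' ->]]].
apply/asboolP; exists (e - e'), (g - g'); rewrite rpredB //; split=> //.
by rewrite raddfB !opprD addrACA; congr (_ + _); apply: addrACA.
Qed.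

HB.instance Definition _ :=
  GRing.isZmodClosed.Build (dual T) coboundaries coboundaries_zmod.

Lemma coboundaries_lattice e : e \in @from_lattice T -> e \in coboundaries.
Proof.
by move=> eL; apply/asboolP; exists e, 0; rewrite raddf0 subrr addr0.
Qed.

Lemma coboundaries_act g : dual_act g - g \in coboundaries.
Proof. by apply/asboolP; exists 0, g; rewrite rpred0 add0r. Qed.

Lemma coboundaries_orbit g v : g \in G ->
  dual_boundary (g v) - dual_boundary v \in coboundaries.
Proof.
move: g; apply: cycle_ind => [|g IHg]; first by rewrite perm1 subrr rpred0.
rewrite permM -dual_act_boundary -(subrK (dual_boundary (g v)) (dual_act _)).
by rewrite -addrA rpredD // coboundaries_act.
Qed.

(** * Means of potentials over orbits *)

(** The coefficient at h p is the coefficient at p of the path translated by h^-1. As h varies, the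
    ends and the starts of these translates run through the same points equally often. *)
Lemma sum_path_translates g w p : g \in G ->
  \sum_(h in G) path_chain tree w (g w) (h p.1, h p.2) = 0.
Proof.
move=> gG.
have pathE h : h \in G -> path_chain tree w (g w) (h p.1, h p.2) =
    b ((g * h^-1)%g w) p - b (h^-1%g w) p.
  move=> hG; rewrite -[w in path_chain _ w _](permKV h) -[g w](permKV h).
  rewrite path_chain_aut => [|x y]; last exact: aut_adj.
  by rewrite -(path_chainB tree s0) !ffunE permM; case: (p).
rewrite (eq_bigr _ pathE) sumrB; apply/eqP; rewrite subr_eq0; apply/eqP.
rewrite (reindex_inj (mulIg g)) /=; apply: eq_big => [h|h _].
  by rewrite groupMr.
by rewrite invMg mulgA mulgV mul1g.
Qed.

Lemma sum_vert_orbit (R : nmodType) (f : V -> R) v :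
  \sum_(g in G) f (g v) =
  (\sum_(u in vert_orbit v) f u) *+ #|('C_G[v | 'P])%g|.
Proof. exact: (sum_orbit 'P _ v f). Qed.

Lemma card_vert_orbit v : (#|vert_orbit v| * #|('C_G[v | 'P])%g|)%N = #|G|.
Proof. exact: card_orbit_stab. Qed.

Hypothesis parityT : parity_B T.

Lemma cycle_swap v g : F T (F T v) = v -> g \in G ->
  (g v = v /\ g (F T v) = F T v) \/ (g v = F T v /\ g (F T v) = v).
Proof.
move=> FFv; move: g; apply: cycle_ind => [|g IHg]; first by rewrite !perm1; left.
by rewrite !permM; case: IHg => -[-> ->]; rewrite ?FFv; [right | left].
Qed.

Lemma pairing_base_arc (a : chain T) u v : edge_chain (@adj T) a -> adj u v ->
  pairing a (b v) - pairing a (b u) = (len [set u; v])%:Z * a (u, v).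
Proof.
by move=> ac uv; rewrite -pairingBr path_chainB path_chain_arc // pairing_arc.
Qed.

(* The potential of the flow from [w] to [g w] sums over <F> to a constant,
   since the translates of the flow cancel.  The constant is computed at a
   fixed vertex of F, or on the edge inverted by F, which has even length. *)
Lemma potential_translate g w : g \in G -> exists c : int, forall v,
  \sum_(u in vert_orbit v) pairing (path_chain tree w (g w)) (b u) =
  c * #|vert_orbit v|%:Z.
Proof.
move=> gG; set a := path_chain tree w (g w).
have ac : edge_chain (@adj T) a by apply: edge_chain_path.
pose phi v := pairing a (b v); pose Phi v := \sum_(h in G) phi (h v).
have Phi_adj u v : adj u v -> Phi u = Phi v.
  move=> uv; apply/eqP; rewrite eq_sym -subr_eq0 /Phi -sumrB.
  rewrite (eq_bigr (fun h : {perm V} => (@len T [set u; v])%:Z * a (h u, h v))).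
    by rewrite -mulr_sumr (sum_path_translates w (u, v) gG) mulr0.
  by move=> h hG; rewrite pairing_base_arc ?aut_adj // aut_len.
have Phi_cst u v : Phi u = Phi v.
  have [_ _ _ conn _] := tree; have /connectP[p up ->] := conn u v.
  elim: p u up => //= x p IHp u /andP[/Phi_adj -> /IHp].
  exact.
have [c Phi_c] : exists c, forall v, Phi v = c * #|G|%:Z.
  have [[v Fv]|[v vFv FFv]] := aut_fix_or_flip tree (@F_adj T).
    exists (phi v) => u; rewrite (Phi_cst u v) /Phi.
    transitivity (\sum_(h in G) phi v).
      apply: eq_bigr => h hG; congr phi; move: h hG.
      by apply: cycle_ind => [|h IHh]; rewrite ?perm1 // permM IHh.
    by rewrite sumr_const -mulr_natr natz.
  have := parityT (k := 1) vFv; rewrite expg1 => /(_ (erefl _) FFv).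
  move=> /negbTE even_l.
  (* The value of the potential at the midpoint of the inverted edge, an integer because the length
     is even. *)
  exists (phi v + ((len [set v; F T v])./2)%:Z * a (v, F T v)) => u.
  rewrite (Phi_cst u v); apply: mulr2n_int_inj.
  rewrite {1}mulr2n -{2}(Phi_cst (F T v)) /Phi -big_split /=.
  transitivity (\sum_(h in G) (phi v + phi (F T v))).
    apply: eq_bigr => h /(cycle_swap FFv) [] [-> ->] //.
    exact: addrC.
  have lenE : (len [set v; F T v])%:Z = (len [set v; F T v])./2%:Z *+ 2.
    by rewrite -{1}(odd_double_half (len _)) even_l add0n -muln2 PoszM -mulr_natr natz.
  have phi_F : phi (F T v) = phi v + (len [set v; F T v])%:Z * a (v, F T v).
    by rewrite -pairing_base_arc // /phi addrC subrK.
  rewrite sumr_const phi_F lenE -mulr_natr natz -mulrnAl; congr (_ * _).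
  by rewrite mulrnDl mulrnAl addrA -mulr2n.
(* [Phi] counts each point of the orbit as often as the stabiliser has elements; this order is
   cancelled. *)
exists c => v; have stab0 : (#|('C_G[v | 'P])%g|%:Z : int) != 0.
  by rewrite eqz_nat -lt0n cardG_gt0.
apply: (mulIf stab0); rewrite -mulrA -PoszM card_vert_orbit -(Phi_c v) /Phi.
by rewrite sum_vert_orbit -mulr_natr natz.
Qed.

Lemma vert_orbitP (u v : V) : reflect (exists2 g, g \in G & u = g v) (u \in vert_orbit v).
Proof.
by apply: (iffP orbitP) => -[g gG gv]; exists g.
Qed.

Lemma vert_orbitM g u v : g \in G -> (g u \in vert_orbit v) = (u \in vert_orbit v).
Proof.
move=> gG; apply/vert_orbitP/vert_orbitP => -[h hG].
  by move/(congr1 g^-1%g); rewrite permK -permM => ->; exists (h * g^-1)%g;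
    rewrite ?groupM ?groupV.
by move=> ->; exists (h * g)%g; rewrite ?groupM ?permM.
Qed.

Lemma vert_orbit_eq (u v : V) : u \in vert_orbit v -> vert_orbit u = vert_orbit v.
Proof. by move/orbit_eqP. Qed.

(** * A square matrix presenting the coinvariants *)

Variables (r : nat) (sg : 'I_r.+1 -> V).
Hypothesis sg0 : sg ord0 = s0.
Hypothesis sgS : forall i, sg i \in SV T.
Hypothesis sg_inj : injective (fun i => vert_orbit (sg i)).
Hypothesis sg_cover : forall s, s \in SV T -> exists i, s \in vert_orbit (sg i).

Lemma vert_orbitS (u v : V) : u \in vert_orbit v -> (u \in SV T) = (v \in SV T).
Proof. by move=> /vert_orbitP[g gG ->]; rewrite aut_SV. Qed.

Lemma sg_orbit i j : sg i \in vert_orbit (sg j) -> i = j.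
Proof.
by move=> ij; apply/sg_inj/vert_orbit_eq.
Qed.

Lemma sum_SV (R : nmodType) (f : V -> R) :
  \sum_(s in SV T) f s = \sum_j \sum_(s in vert_orbit (sg j)) f s.
Proof.
rewrite -partition_disjoint_bigcup => [|i j]; last first.
  apply: contraNT => /pred0Pn[v /andP[/= iv jv]]; apply/eqP/sg_inj.
  by rewrite -(vert_orbit_eq iv) -(vert_orbit_eq jv).
apply: eq_bigl => s; apply/idP/bigcupP => [/sg_cover[i si]|[i _ /vert_orbitS->] //].
by exists i.
Qed.

(** The map from Z^S to Z^(S/F), applied to the representative of f that vanishes at [s0]. This
    normalisation is not F-invariant, hence the results hold modulo the vector of orbit sizes. *)
Definition orbit_sums (f : dual T) : 'rV[int]_r.+1 :=
  \row_j \sum_(s in vert_orbit (sg j)) f (base_path s).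

Lemma orbit_sums_zmod : zmod_morphism orbit_sums.
Proof.
by move=> f g; apply/rowP => j; rewrite !mxE -sumrB.
Qed.

HB.instance Definition _ := GRing.isZmodMorphism.Build (dual T) 'rV[int]_r.+1
  orbit_sums orbit_sums_zmod.

(** The vector of orbit sizes occupies row 0, where the path from [s0] to itself would give a zero
    row. *)
Definition coinv_mx : 'M[int]_r.+1 := \matrix_i
  if i == ord0 then \row_j #|vert_orbit (sg j)|%:Z
  else orbit_sums (pairing_dual (base_path (sg i))).

Definition coinv_span : {pred 'rV[int]_r.+1} := fun x =>
  `[< exists z, x = z *m coinv_mx >].

Lemma coinv_span_zmod : zmod_closed coinv_span.
Proof.
split; first by apply/asboolP; exists 0; rewrite mul0mx.
move=> _ _ /asboolP[z ->] /asboolP[z' ->]; apply/asboolP.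
by exists (z - z'); rewrite mulmxBl.
Qed.

HB.instance Definition _ :=
  GRing.isZmodClosed.Build 'rV[int]_r.+1 coinv_span coinv_span_zmod.

Lemma coinv_span_row i : row i coinv_mx \in coinv_span.
Proof. by apply/asboolP; exists (delta_mx ord0 i); rewrite -rowE. Qed.

Lemma coinv_span_cst (c : int) :
  \row_j (c * #|vert_orbit (sg j)|%:Z) \in coinv_span.
Proof.
suff -> : \row_j (c * #|vert_orbit (sg j)|%:Z) = row ord0 coinv_mx *~ c.
  by rewrite rpredMz // coinv_span_row.
rewrite rowK eqxx -scaler_int; apply/rowP => j; rewrite !mxE intz.
by [].
Qed.

(** Only one point of each orbit has a row. Moving from [sg i] to [g (sg i)] adds a path whose orbit
    sums are a multiple of row 0 by [potential_translate]. *)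
Lemma orbit_sums_lattice e : e \in @from_lattice T -> orbit_sums e \in coinv_span.
Proof.
move=> /asboolP[a ea].
have -> : e = pairing_dual a by apply/val_inj/funext.
rewrite (lattice_decomp a) !raddf_sum; apply: rpred_sum => s sS.
rewrite !raddfMz /= rpredMz //; have [i] := sg_cover sS.
move=> /vert_orbitP[g gG s_eq].
rewrite -(subrK (pairing_dual (base_path (sg i))) (pairing_dual _)) raddfD.
apply: rpredD; last first.
  have [i0|i0] := eqVneq i ord0; first by rewrite i0 sg0 base_path0 !raddf0 rpred0.
  by have := coinv_span_row i; rewrite rowK (negbTE i0).
have [c cE] := potential_translate (sg i) gG.
rewrite [X in X \in _](_ : _ = \row_j (c * #|vert_orbit (sg j)|%:Z)).
  exact: coinv_span_cst.
apply/rowP => j; rewrite !mxE -cE; apply: eq_bigr => u uj.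
rewrite -[LHS]pairingBl -s_eq -(path_chainB tree s0).
have uS : u \in SV T by rewrite (vert_orbitS uj).
by rewrite -!base_pathE // s_eq aut_SV.
Qed.

Lemma orbit_sums_act g : orbit_sums (dual_act g - g) \in coinv_span.
Proof.
(* The inverse of F carries base paths to paths from F^-1 s0; c corrects this change of base
   point. *)
pose c := - g (base_path ((F T)^-1%g s0)).
suff -> : orbit_sums (dual_act g - g) = \row_j (c * #|vert_orbit (sg j)|%:Z).
  exact: coinv_span_cst.
have FVG : (F T)^-1%g \in G by rewrite groupV cycle_id.
have act_path s : s \in SV T ->
    dual_act g (base_path s) = g (base_path ((F T)^-1%g s)) + c.
  move=> sS; rewrite /c -raddfB /=; congr (g _); apply: lattice_inj => v vS.
  rewrite raddfB /= !lattice_boundary_path ?aut_SV // opprB addrA subrK.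
  have := dual_act_boundary v => /(congr1 (fun h : dual T => h (base_path s))) /= ->.
  rewrite lattice_boundary_path // -{1}(permKV (F T) s) -{1}(permKV (F T) s0).
  by rewrite !(inj_eq perm_inj).
apply/rowP => j; rewrite !mxE.
rewrite (eq_bigr (fun s => g (base_path ((F T)^-1%g s)) + c - g (base_path s))).
  rewrite sumrB big_split /= sumr_const -mulr_natr natz addrAC.
  rewrite [X in X - _ + _](reindex_inj (@perm_inj _ (F T))) /=.
  rewrite [X in X - _ + _](_ : _ = \sum_(s in vert_orbit (sg j)) g (base_path s)).
    by rewrite subrr add0r.
  apply: eq_big => s; last by rewrite permK.
  by rewrite vert_orbitM ?cycle_id.
by move=> s sj; rewrite -act_path ?(vert_orbitS sj).
Qed.

Lemma coinv_spanP f : (orbit_sums f \in coinv_span) = (f \in coboundaries).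
Proof.
(* Modulo coboundaries the functionals [dual_boundary] agree along an orbit, so h is determined by
   its orbit sums. *)
have reduce h : h - \sum_j dual_boundary (sg j) *~ orbit_sums h ord0 j \in coboundaries.
  rewrite {1}(dual_decomp h) sum_SV -sumrB; apply: rpred_sum => j _.
  rewrite mxE mulrz_sumr -sumrB; apply: rpred_sum => s /vert_orbitP[g gG ->].
  by rewrite -mulrzBl rpredMz // coboundaries_orbit.
apply/idP/idP => [/asboolP[z yE]|]; last first.
  move=> /asboolP[e [g [eL ->]]]; rewrite raddfD rpredD //.
    exact: orbit_sums_lattice.
  exact: orbit_sums_act.
rewrite -(subrK (\sum_j dual_boundary (sg j) *~ orbit_sums f ord0 j) f).
apply: rpredD => //; rewrite yE.
have -> : \sum_j dual_boundary (sg j) *~ (z *m coinv_mx) ord0 j =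
   \sum_i (\sum_j dual_boundary (sg j) *~ coinv_mx i j) *~ z ord0 i.
  under eq_bigr do rewrite mxE mulrz_sumr.
  rewrite exchange_big /=; apply: eq_bigr => i _; rewrite mulrz_suml.
  by apply: eq_bigr => j _; rewrite -mulrzA mulrC.
apply: rpred_sum => i _; apply: rpredMz.
have [->|i0] := eqVneq i ord0.
  (* Row 0 gives the sum of all [dual_boundary s], which is 0, with each s replaced by the
     representative of its orbit. *)
  rewrite (eq_bigr (fun j => \sum_(s in vert_orbit (sg j)) dual_boundary (sg j))).
    rewrite -[X in X \in _]opprK rpredN -[X in X \in _]add0r -{1}sum_dual_boundary.
    rewrite sum_SV -sumrB; apply: rpred_sum => j _; rewrite -sumrB.
    by apply: rpred_sum => s /vert_orbitP[g gG ->]; apply: coboundaries_orbit.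
  move=> j _; by rewrite !mxE sumr_const.
rewrite (eq_bigr (fun j => dual_boundary (sg j) *~
   orbit_sums (pairing_dual (base_path (sg i))) ord0 j)); last first.
  by move=> j _; rewrite [coinv_mx _ _]mxE (negbTE i0).
have := reduce (pairing_dual (base_path (sg i))); rewrite -rpredN opprB.
move=> h; have := coboundaries_lattice (pairing_dual_lattice (base_path (sg i))).
by move/(rpredD h); rewrite subrK.
Qed.

(** Surjectivity can fail on the nose, for instance when the orbit of [s0] is a single point: that
    coordinate is then always 0. *)
Lemma orbit_sums_surj x : exists f, x - orbit_sums f \in coinv_span.
Proof.
pose f := \sum_j dual_boundary (sg j) *~ x ord0 j; exists f.
suff -> : x - orbit_sums f = \row_j (x ord0 ord0 * #|vert_orbit (sg j)|%:Z).
  exact: coinv_span_cst.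
apply/rowP => k; rewrite !mxE.
rewrite (eq_bigr (fun s => \sum_j x ord0 j * ((sg j == s)%:Z - (sg j == s0)%:Z))); last first.
  move=> s sk; rewrite [LHS](raddf_sum (dual_eval (base_path s))) /=.
  apply: eq_bigr => j _; rewrite raddfMz /= mulrzz mulrC; congr (_ * _).
  by apply: lattice_boundary_path; rewrite (vert_orbitS sk).
rewrite exchange_big /=.
rewrite (eq_bigr (fun j => (j == k)%:Z * x ord0 j
                           - (j == ord0)%:Z * x ord0 j * #|vert_orbit (sg k)|%:Z)).
  rewrite sumrB (bigD1 k) //= eqxx mul1r big1 ?addr0 => [|j /negbTE->]; last by rewrite mul0r.
  rewrite (bigD1 ord0) // eqxx mul1r big1 ?addr0 => [|j /negbTE->]; last by rewrite !mul0r.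
  by rewrite opprB addrC subrK; apply: addr0.
move=> j _; rewrite -mulr_sumr sumrB mulrBr; congr (_ - _).
  rewrite mulrC; congr (_ * _); have [->|jk] := eqVneq j k.
    rewrite (bigD1 (sg k)) ?eqxx ?orbit_refl //= big1 ?addr0 // => s /andP[_].
    by rewrite eq_sym => /negbTE->.
  rewrite big1 // => s sk; case: eqP => // js; case/eqP: jk; apply: sg_orbit.
  by rewrite js.
rewrite sumr_const -mulr_natr natz -[in RHS]mulrA mulrCA; congr (_ * (_ * _)).
have [->|j0] := eqVneq j ord0; first by rewrite sg0 eqxx.
case: eqP => // js0; case/eqP: j0; apply: sg_orbit.
by rewrite js0 -sg0 orbit_refl.
Qed.

(** * Finiteness of the index *)

Definition gram_mx : 'M[int]_#|SV T :\ s0| := \matrix_(i, j)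
  pairing (val (base_path (enum_val i))) (val (base_path (enum_val j))).

Lemma enum_valS (i : 'I_#|SV T :\ s0|) : enum_val i \in SV T.
Proof. by have := enum_valP i; rewrite !inE => /andP[]. Qed.

Lemma pairing_combination (z : 'rV[int]_#|SV T :\ s0|) j :
  pairing_dual (\sum_i base_path (enum_val i) *~ z ord0 i) (base_path (enum_val j))
  = (z *m gram_mx) ord0 j.
Proof.
rewrite raddf_sum dual_sum mxE; apply: eq_bigr => i _.
by rewrite raddfMz dualMz mxE mulrzz mulrC.
Qed.

Lemma det_gram_neq0 : \det gram_mx != 0.
Proof.
apply/det0P => -[v v0 vG]; case/eqP: v0.
pose a := \sum_i base_path (enum_val i) *~ v ord0 i.
have aE j : pairing_dual a (base_path (enum_val j)) = (v *m gram_mx) ord0 j.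
  exact: pairing_combination.
have a0 : a = 0.
  apply/val_inj/energy_eq0; first exact: edge_chain_lattice.
  rewrite -pairing_mulr2n; try exact: edge_chain_lattice.
  transitivity (pairing_dual a a *+ 2); first by [].
  rewrite {2}/a raddf_sum big1 ?mul0rn // => j _.
  by rewrite raddfMz /= [X in X *~ _]aE vG mxE mul0rz.
apply/rowP => i; rewrite [RHS]mxE.
have := raddf0 (lattice_boundary (enum_val i)); rewrite -{1}a0 /a raddf_sum /=.
rewrite (bigD1 i) //= big1 ?addr0 => [|j ji].
  rewrite raddfMz /= lattice_boundary_path ?enum_valS // eqxx.
  have := enum_valP i; rewrite !inE => /andP[/negbTE -> _].
  by rewrite subr0 mulrzz mul1r.
rewrite raddfMz /= lattice_boundary_path ?enum_valS // (inj_eq enum_val_inj).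
have := enum_valP i; rewrite !inE => /andP[/negbTE -> _].
by rewrite eq_sym (negbTE ji) mul0rz.
Qed.

(** Cramer's rule: after multiplication by the determinant, the adjugate of the Gram matrix solves
    for the lattice vector. *)
Lemma lattice_exponent : exists2 N, (0 < N)%N &
  forall f : dual T, f *+ N \in @from_lattice T.
Proof.
exists `|\det gram_mx|%N; first by rewrite absz_gt0 det_gram_neq0.
move=> f; suff: f *~ \det gram_mx \in @from_lattice T.
  case: (\det gram_mx) => n //; rewrite NegzE mulrNz rpredN.
  by rewrite abszN.
pose x := \row_i f (base_path (enum_val i)) : 'rV[int]_#|SV T :\ s0|.
pose z := x *m \adj gram_mx.
have zG : z *m gram_mx = \det gram_mx *: x.
  by rewrite /z -mulmxA mul_adj_mx mul_mx_scalar.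
pose a := \sum_i base_path (enum_val i) *~ z ord0 i.
suff -> : f *~ \det gram_mx = pairing_dual a by apply: pairing_dual_lattice.
apply: dual_inj => s sS; rewrite dualMz.
have [->|ss0] := eqVneq s s0; first by rewrite base_path0 !raddf0 mul0rz.
have sS' : s \in SV T :\ s0 by rewrite !inE ss0.
rewrite -(enum_rankK_in sS' sS'); set j := enum_rank_in _ _.
by rewrite pairing_combination zG !mxE mulrzz mulrC.
Qed.

(** N times each unit vector lies in the row span, so some integer matrix times [coinv_mx] is the
    scalar matrix N. *)
Lemma det_coinv_neq0 : \det coinv_mx != 0.
Proof.
have [N N0 NL] := lattice_exponent.
have rows j : exists z : 'rV[int]_r.+1, delta_mx ord0 j *+ N = z *m coinv_mx.
  pose d : 'rV[int]_r.+1 := delta_mx ord0 j.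
  suff : d *+ N \in coinv_span by move=> /asboolP[z]; exists z.
  have [f fE] := orbit_sums_surj d; rewrite -(subrK (orbit_sums f) d) mulrnDl.
  apply: rpredD; first exact: rpredMn.
  by rewrite -raddfMn orbit_sums_lattice.
have [X XE] := choice rows.
have : \det ((\matrix_j X j) *m coinv_mx) != 0.
  have -> : (\matrix_j X j) *m coinv_mx = N%:R%:M.
    apply/row_matrixP => j; rewrite row_mul rowK -XE.
    by apply/rowP => k; rewrite mulmxnE !mxE eqxx /= mulrnAC eq_sym.
  by rewrite det_scalar expf_neq0 // pnatr_eq0 -lt0n.
by rewrite det_mulmx mulf_eq0 negb_or => /andP[].
Qed.

(** * Counting the invariants of the discriminant group *)

Local Notation A := (Quotient.quot (@from_lattice T)).

Lemma pi_eq0 f : (\pi_A f == 0) = (f \in @from_lattice T).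
Proof. by rewrite -[f in RHS]subr0 Quotient.idealrBE raddf0. Qed.

Definition disc_coboundary (x : A) : A := disc_act x - x.

Lemma disc_coboundary_pi f : disc_coboundary (\pi_A f) = \pi_A (dual_act f - f).
Proof. by rewrite /disc_coboundary disc_act_pi raddfB. Qed.

Lemma disc_coboundary_zmod : zmod_morphism disc_coboundary.
Proof.
elim/quotW => f; elim/quotW => g.
rewrite -raddfB !disc_coboundary_pi -raddfB; congr (\pi_A _).
by rewrite raddfB !opprD addrACA.
Qed.

HB.instance Definition _ := GRing.isZmodMorphism.Build A A
  disc_coboundary disc_coboundary_zmod.

Lemma finite_disc : finite_set [set: A]%classic.
Proof.
have [N N0 NL] := lattice_exponent.
pose th (c : {ffun V -> 'I_N}) : A :=
  \pi_A (\sum_(s in SV T) dual_boundary s *+ c s).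
apply: (@sub_finite_set _ _ [set th c | c in [set: {ffun V -> 'I_N}]]%classic).
  move=> x _; elim/quotW: x => f.
  have lt_mod s : (`|(f (base_path s) %% N)%Z| < N)%N.
    by rewrite -ltz_nat gez0_abs ?modz_ge0 ?ltz_pmod // eqz_nat -lt0n.
  exists [ffun s => Ordinal (lt_mod s)] => //.
  apply/eqP; rewrite /th -subr_eq0 -raddfB pi_eq0 {2}(dual_decomp f) -sumrB.
  apply: rpred_sum => s _; rewrite ffunE /= [_ *+ _]pmulrn gez0_abs;
    last by rewrite modz_ge0 ?eqz_nat -?lt0n.
  rewrite -mulrzBr {2}(divz_eq (f (base_path s)) N) opprD addrCA subrr addr0.
  by rewrite mulrNz rpredN mulrC mulrzA rpredMz // -pmulrn.
by apply: finite_image; apply: finite_finset.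
Qed.

Lemma tamagawa_det : tamagawa T = `|\det coinv_mx|%N.
Proof.
have [Y [h [cY h_surj hP]]] := int_mx_index det_coinv_neq0.
rewrite -cY /tamagawa.
(* Invariants are the kernel of F - 1. By [coinv_spanP] the labels of orbit sums separate exactly
   the classes of its cokernel, whichever representatives are taken. *)
rewrite -(@card_fix_finite_quotient A disc_coboundary Y
            (fun x => h (orbit_sums (generic_quotient.repr x)))).
- congr (#|` fset_set _|); apply/seteqP; split=> x; rewrite /= /disc_coboundary.
    by move=> ->; rewrite subrr.
  by move/eqP; rewrite subr_eq0 => /eqP.
- exact: finite_disc.
- move=> y; have [x <-] := h_surj y; have [f fx] := orbit_sums_surj x.
  exists (\pi_A f); apply/hP/asboolP.
  change (orbit_sums (generic_quotient.repr (\pi_A f)) - x \in coinv_span).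
  rewrite -[_ - x](subrKA (orbit_sums f)) rpredD // -1?opprB ?rpredN //.
  rewrite -raddfB coinv_spanP coboundaries_lattice // Quotient.idealrBE.
  by rewrite reprK.
move=> x x'; split => [/hP xx'|[z zE]].
  have : generic_quotient.repr x - generic_quotient.repr x' \in coboundaries.
    by rewrite -coinv_spanP raddfB; apply/asboolP.
  move=> /asboolP[e [g [eL xe]]]; exists (\pi_A g).
  transitivity (\pi_A (dual_act g - g)); last by rewrite -disc_coboundary_pi.
  rewrite -[x]reprK -[x']reprK -raddfB xe raddfD.
  by apply/eqP; rewrite -subr_eq0 addrK pi_eq0.
apply/hP/asboolP; change (orbit_sums (generic_quotient.repr x)
  - orbit_sums (generic_quotient.repr x') \in coinv_span).
rewrite -raddfB coinv_spanP; pose g := generic_quotient.repr z.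
rewrite -[_ - _](subrK (dual_act g - g)) rpredD ?coboundaries_act //.
rewrite coboundaries_lattice // -pi_eq0 raddfB subr_eq0 raddfB /= !reprK.
by rewrite -disc_coboundary_pi reprK zE.
Qed.

(** * The length pairing on the quotient tree *)

(** By [orbit_coefE], the coefficient at p of the sum of all translates of the path from [s0] to
    w. *)
Definition orbit_coef w (p : V * V) : int :=
  \sum_(g in G) b w (g p.1, g p.2).

Lemma orbit_coefE w p :
  orbit_coef w p = \sum_(g in G) (b (g w) p - b (g s0) p).
Proof.
rewrite /orbit_coef (reindex_inj invg_inj) /=; apply: eq_big => g; first exact: groupV.
rewrite groupV => gG; rewrite -{1}(permK g w) -{1}(permK g s0).
rewrite path_chain_aut => [|x y]; last by rewrite aut_adj ?groupV.
by rewrite -(path_chainB tree s0) !ffunE; case: (p).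
Qed.

Lemma orbit_coef0 p : orbit_coef s0 p = 0.
Proof. by rewrite orbit_coefE big1 // => g _; rewrite subrr. Qed.

Lemma orbit_coef_orbit u v p : u \in vert_orbit v -> orbit_coef u p = orbit_coef v p.
Proof.
move=> /vert_orbitP[g gG ->]; rewrite !orbit_coefE !sumrB; congr (_ - _).
rewrite [RHS](reindex_inj (mulgI g)) /=; apply: eq_big => h; first by rewrite groupMl.
by rewrite permM.
Qed.

Lemma orbit_coefM w g p : g \in G -> orbit_coef w (g p.1, g p.2) = orbit_coef w p.
Proof.
move=> gG; rewrite /orbit_coef [RHS](reindex_inj (mulgI g)) /=.
by apply: eq_big => h; rewrite ?groupMl // => _; rewrite !permM.
Qed.

Lemma orbit_coefC w p : orbit_coef w (p.2, p.1) = - orbit_coef w p.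
Proof.
rewrite /orbit_coef -sumrN; apply: eq_bigr => g _ /=.
exact: (path_chainC _ _ _ (_, _)).
Qed.

Lemma orbit_coef_adj w p : orbit_coef w p != 0 -> adj p.1 p.2.
Proof.
apply: contraNT => p_adj; apply/eqP; apply: big1 => g gG; apply/eqP.
by apply: contraNT p_adj => /path_chain_adj /=; rewrite aut_adj.
Qed.

(** * Edges of the quotient tree *)

Lemma edge_orbitP (e f : {set V}) :
  reflect (exists2 g, g \in G & e = [set (g : {perm V}) v | v in f]) (e \in edge_orbit f).
Proof. by apply: (iffP orbitP) => -[g gG gv]; exists g. Qed.

Lemma edge_orbit_eq (e f : {set V}) : e \in edge_orbit f -> edge_orbit e = edge_orbit f.
Proof. by move/orbit_eqP. Qed.

Lemma edge_orbitM g u v : g \in G ->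
  edge_orbit [set g u; g v] = @edge_orbit T [set u; v].
Proof.
move=> gG; apply/edge_orbit_eq/edge_orbitP; exists g => //.
by rewrite imsetU1 imset_set1.
Qed.

Lemma set2_eq (u v x y : V) : [set u; v] = [set x; y] ->
  (u, v) = (x, y) \/ (u, v) = (y, x).
Proof.
move=> eq_uv; have := set21 u v; have := set22 u v; rewrite eq_uv !inE.
have := set21 x y; have := set22 x y; rewrite -eq_uv !inE.
by do 4!case/orP => /eqP ?; subst; auto.
Qed.

Lemma edge_orbit_arc (p q : V * V) :
  edge_orbit [set p.1; p.2] = @edge_orbit T [set q.1; q.2] ->
  exists2 g, g \in G & p = (g q.1, g q.2) \/ p = (g q.2, g q.1).
Proof.
move=> pq; have : [set p.1; p.2] \in edge_orbit [set q.1; q.2].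
  by rewrite -pq orbit_refl.
case/edge_orbitP => g gG; rewrite imsetU1 imset_set1 => /set2_eq pE; exists g => //.
by case: p {pq} pE => ? ?.
Qed.

(** Another choice of arc changes [orbit_coef] at most by a sign. *)
Definition edge_arc (e' : {set {set V}}) : V * V :=
  odflt (s0, s0) [pick p | adj p.1 p.2 && (edge_orbit [set p.1; p.2] == e')].

Lemma edge_arcP e' : e' \in quot_edges T ->
  adj (edge_arc e').1 (edge_arc e').2 /\
  edge_orbit [set (edge_arc e').1; (edge_arc e').2] = e'.
Proof.
rewrite /edge_arc; case: pickP => [p /andP[-> /eqP ->] //|none].
case/imsetP => e /imsetP[p]; rewrite inE => p_adj -> e'E.
by have := none p; rewrite p_adj e'E eqxx.
Qed.

Lemma quot_edges_arc u v : adj u v -> @edge_orbit T [set u; v] \in quot_edges T.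
Proof.
by move=> uv; apply: imset_f; apply/imsetP; exists (u, v); rewrite ?inE.
Qed.

Lemma card_edge_arcs e' : e' \in quot_edges T ->
  #|[set p : V * V | adj p.1 p.2 && (edge_orbit [set p.1; p.2] == e')]| = (#|e'| * 2)%N.
Proof.
have [sym irr _ _ _] := tree.
case/imsetP => e0 /imsetP[p0]; rewrite inE => p0_adj -> ->.
rewrite -sum1dep_card (partition_big (fun p => [set p.1; p.2])
   (mem (edge_orbit [set p0.1; p0.2]))) /=; last first.
  by move=> p /andP[_ /eqP <-]; rewrite orbit_refl.
rewrite -sum_nat_const; apply: eq_bigr => _ /edge_orbitP[g gG ->].
rewrite imsetU1 imset_set1 sum1dep_card; set u := g _; set v := g _.
have uv : adj u v by rewrite aut_adj.
have neq_uv : u != v by apply: contraTneq uv => ->; rewrite irr.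
transitivity #|[set (u, v); (v, u)]|; last first.
  by rewrite cards2 xpair_eqE (negbTE neq_uv).
apply: eq_card => -[x y]; rewrite !inE /=; apply/idP/idP.
  by case/andP => _ /eqP/set2_eq[] ->; rewrite eqxx ?orbT.
by case/orP => /eqP[-> ->]; rewrite ?[adj v u]sym ?[[set v; u]]setUC uv edge_orbitM ?eqxx.
Qed.

Lemma sum_arcs (R : nmodType) (f : V * V -> R) :
  (forall p, ~~ adj p.1 p.2 -> f p = 0) ->
  (forall p, f (p.2, p.1) = f p) ->
  (forall g p, g \in G -> f (g p.1, g p.2) = f p) ->
  \sum_p f p = \sum_(e' in quot_edges T) f (edge_arc e') *+ (#|e'| * 2).
Proof.
move=> f_adj fC fM; rewrite (bigID (fun p => adj p.1 p.2)) /= [X in _ + X]big1 ?addr0 //.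
rewrite (partition_big (fun p => edge_orbit [set p.1; p.2]) (mem (quot_edges T))) /=;
  last by move=> [u v]; apply: quot_edges_arc.
apply: eq_bigr => e' e'E; rewrite -card_edge_arcs // -sumr_const.
apply: eq_big => [p|p /andP[_ /eqP pe]]; first by rewrite inE.
have [_ ae] := edge_arcP e'E; rewrite -ae in pe.
have [g gG [->|->]] := edge_orbit_arc pe; first exact: fM.
by rewrite -[LHS]fC /= fM.
Qed.

Lemma arc_actP : is_action [set: {perm V}] (fun (p : V * V) (g : {perm V}) => (g p.1, g p.2)).
Proof.
apply: is_total_action => [[u v]|[u v] g h] /=; first by rewrite !perm1.
by rewrite !permM.
Qed.

Definition arc_act := Action arc_actP.

(* If no iterate of F inverts the edge, an arc and its edge have the same
   stabiliser; otherwise the sum over the orbit cancels. *)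
Lemma dvd_orbit_coef w e' : e' \in quot_edges T ->
  (#|G|%:Z %| orbit_coef w (edge_arc e') * #|e'|%:Z)%Z.
Proof.
move=> e'E; have [_] := edge_arcP e'E; set p := edge_arc e' => <-.
have [/exists_inP[g gG /eqP gp]|/exists_inPn noflip] :=
    boolP [exists g in G, (g p.1, g p.2) == (p.2, p.1)].
  have /eqP := orbit_coefM w p gG; rewrite gp orbit_coefC eq_sym -addr_eq0.
  by rewrite -mulr2n mulrn_eq0 /= => /eqP->; rewrite mul0r dvdz0.
have -> : orbit_coef w p =
   (\sum_(q in orbit arc_act G p) b w q) *+ #|('C_G[p | arc_act])%g|.
  exact: (sum_orbit arc_act).
have -> : ('C_G[p | arc_act] = 'C_G[[set p.1; p.2] | 'P^*])%g.
  apply/setP => g; rewrite !inE; apply: andb_id2l => gG; rewrite !sub1set !inE /=.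
  have -> : setact 'P [set p.1; p.2] g = [set g p.1; g p.2].
    by rewrite /setact imsetU1 imset_set1.
  apply/eqP/eqP => [gp|/set2_eq[gp|gp]].
  - by have [-> ->] : (g p.1, g p.2) = (p.1, p.2) by case: (p) gp.
  - by rewrite [LHS]gp; case: (p).
  - by case/eqP: (noflip g gG).
rewrite -mulr_natr natz -mulrA -PoszM mulnC card_orbit_stab.
exact: dvdz_mull.
Qed.

(** The coefficient at e' of the image in T' of the path from [s0] to w: [orbit_coef] counts it once
    for each element of the edge stabiliser, of order #|G| / #|e'|. An inverted edge gets 0. *)
Definition quot_coef w (e' : {set {set V}}) : int :=
  ((orbit_coef w (edge_arc e') * #|e'|%:Z) %/ #|G|%:Z)%Z.

Lemma quot_coefE w e' : e' \in quot_edges T ->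
  quot_coef w e' * #|G|%:Z = orbit_coef w (edge_arc e') * #|e'|%:Z.
Proof. by move=> e'E; rewrite divzK // dvd_orbit_coef. Qed.

Lemma sum_orbit_coef w (f : V * V -> int) :
  (forall g p, g \in G -> adj p.1 p.2 -> f (g p.1, g p.2) = f p) ->
  \sum_p orbit_coef w p * f p = (\sum_p b w p * f p) * #|G|%:Z.
Proof.
move=> fM; rewrite -natz mulr_natr -sumr_const /orbit_coef.
under eq_bigr do rewrite mulr_suml.
rewrite exchange_big /=; apply: eq_bigr => g gG.
pose gg (p : V * V) := (g p.1, g p.2).
have gg_inj : injective gg by move=> [u v] [u' v'] [/perm_inj-> /perm_inj->].
rewrite [RHS](reindex_inj gg_inj) /=; apply: eq_bigr => p _.
have [->|/path_chain_adj] := eqVneq (b w (g p.1, g p.2)) 0; first by rewrite !mul0r.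
by rewrite /= aut_adj // => p_adj; rewrite -(fM g).
Qed.

(** The translates of the path to v sum to an invariant chain, so the path to u may be replaced by
    its translates at the cost of a factor #|G|; the summand then depends only on the edge orbit. *)
Lemma orbit_energy u v : u \in SV T -> v \in SV T ->
  (\sum_(g in G) (pairing (b u) (b (g v)) - pairing (b u) (b (g s0)))) * #|G|%:Z =
  \sum_(e' in quot_edges T) (len [set (edge_arc e').1; (edge_arc e').2])%:Z
     * orbit_coef u (edge_arc e') * orbit_coef v (edge_arc e') * #|e'|%:Z.
Proof.
move=> uS vS; apply: mulr2n_int_inj; rewrite -mulrnAl -sumrMnl.
have bE w : edge_chain (@adj T) (b w) by apply: edge_chain_path.
rewrite (eq_bigr (fun g : {perm V} => energy (b u) (b (g v) - b (g s0)))); last first.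
  by move=> g _; rewrite -pairingBr pairing_mulr2n //; apply: edge_chainB.
rewrite /energy exchange_big /=.
rewrite (eq_bigr (fun p => b u p * ((len [set p.1; p.2])%:Z * orbit_coef v p))); last first.
  move=> p _; rewrite orbit_coefE mulrCA mulrA mulr_sumr.
  by apply: eq_bigr => g _; rewrite !ffunE.
rewrite -sum_orbit_coef; last first.
  by move=> g p gG p_adj /=; rewrite orbit_coefM // aut_len.
rewrite sum_arcs.
- rewrite -sumrMnl; apply: eq_bigr => e' _.
  by rewrite mulrnA -[_ *+ #|e'|]mulr_natr natz mulrCA mulrA.
- by move=> p; apply: contraNeq; rewrite mulf_eq0 negb_or => /andP[/orbit_coef_adj].
- by move=> p; rewrite !orbit_coefC setUC mulrN mulrNN.
- move=> g p gG /=; rewrite !orbit_coefM //.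
  have [->|/orbit_coef_adj p_adj] := eqVneq (orbit_coef u p) 0; first by rewrite !mul0r.
  by rewrite aut_len.
Qed.

Local Notation tl i := (sg (lift ord0 i)).

Definition quot_gram : 'M[rat]_r := \matrix_(i, j)
  \sum_(e' in quot_edges T) (quot_len e' * (quot_coef (tl i) e')%:~R)
                            * (quot_coef (tl j) e')%:~R.

Lemma det_coinv_mx : (\det coinv_mx)%:~R =
  (\prod_j #|vert_orbit (sg j)|%:R) * \det quot_gram.
Proof.
have q0 v : #|vert_orbit v|%:R != 0 :> rat.
  by rewrite pnatr_eq0 -lt0n; apply/card_gt0P; exists v; apply: orbit_refl.
have G0 : #|G|%:R != 0 :> rat by rewrite pnatr_eq0 -lt0n cardG_gt0.
(* An orbit sum is the orbit size times the mean over the group: the sizes factor out of the columns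
   and row 0 becomes a row of ones. *)
pose av u v : rat := (\sum_(g in G) pairing (b u) (b (g v)))%:~R / #|G|%:R.
pose N := \matrix_(i < r.+1, j < r.+1) if i == ord0 then 1 else av (sg i) (sg j).
have -> : (\det coinv_mx)%:~R = \det (N *m diag_mx (\row_j #|vert_orbit (sg j)|%:R)).
  rewrite -det_map_mx; congr (\det _); apply/matrixP => i j; rewrite mul_mx_diag !mxE.
  case: eqP => _; rewrite !mxE ?mul1r //.
  have -> : \sum_(s in vert_orbit (sg j)) pairing_dual (base_path (sg i)) (base_path s)
     = \sum_(s in vert_orbit (sg j)) pairing (b (sg i)) (b s).
    by apply: eq_bigr => s sj; rewrite -!base_pathE // (vert_orbitS sj).
  apply: (mulIf G0); rewrite /av mulrAC divfK //.
  rewrite (sum_vert_orbit (fun v => pairing (b (sg i)) (b v))).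
  rewrite rmorphMn /= -(card_vert_orbit (sg j)) natrM -[in RHS]mulr_natr mulrA.
  exact: mulrAC.
rewrite det_mulmx det_diag mulrC; congr (_ * _).
  by apply: eq_bigr => j _; rewrite mxE.
rewrite det_row1; last by move=> j; rewrite mxE.
congr (\det _); apply/matrixP => i j; rewrite !mxE /= sg0.
rewrite /av -mulrBl -rmorphB /= -sumrB.
(* One factor #|G| comes from the mean, the other from [orbit_energy]. *)
apply: (mulIf G0); apply: (mulIf G0); rewrite divfK //.
have <- : (#|G|%:Z)%:~R = #|G|%:R :> rat by rewrite -pmulrn.
rewrite -rmorphM /= orbit_energy // rmorph_sum /= !mulr_suml.
apply: eq_bigr => e' e'E; have [_ ae] := edge_arcP e'E.
have e'0 : #|e'|%:R != 0 :> rat.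
  rewrite pnatr_eq0 -lt0n -ae; apply/card_gt0P.
  by exists [set (edge_arc e').1; (edge_arc e').2]; apply: orbit_refl.
have coefE v : (orbit_coef v (edge_arc e'))%:~R
    = (quot_coef v e')%:~R * (#|G|%:Z)%:~R / #|e'|%:R :> rat.
  rewrite -rmorphM /= quot_coefE // rmorphM /= -[(Posz #|e'|)%:~R]pmulrn.
  by rewrite mulfK.
have lE : quot_len e' = (len [set (edge_arc e').1; (edge_arc e').2])%:R / #|e'|%:R.
  rewrite -{1}ae quot_len_orbit ?ae //; apply/imsetP; exists (edge_arc e') => //.
  by rewrite inE; case: (edge_arcP e'E).
rewrite lE !rmorphM /= !coefE -[(Posz (len _))%:~R]pmulrn -[(Posz #|e'|)%:~R]pmulrn.
by field.
Qed.

(** * Minors and separating sets of edges *)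

Definition removal_mx (D : {set {set {set V}}}) : 'M[int]_r :=
  \matrix_(i < r, k < r) quot_coef (tl i) (nth set0 (enum D) k).

Lemma det_quot_gram : \det quot_gram =
  \sum_(D : {set {set {set V}}} | (D \subset quot_edges T) && (#|D| == r))
     (\prod_(e' in D) quot_len e') * (\det (removal_mx D))%:~R ^+ 2.
Proof.
rewrite (cauchy_binet _ (fun i e' => quot_len e' * (quot_coef (tl i) e')%:~R)
  (fun e' j => (quot_coef (tl j) e')%:~R) set0).
apply: eq_bigr => D /andP[_ /eqP cD].
rewrite (big_nth_enum _ set0 _ cD) expr2 mulrA -det_map_mx; congr (_ * _); last first.
  by rewrite -det_tr; congr (\det _); apply/matrixP => i j; rewrite !mxE.
pose lD := \row_(k < r) quot_len (nth set0 (enum D) k).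
transitivity (\det (map_mx intr (removal_mx D) *m diag_mx lD)).
  congr (\det _); apply/matrixP => i j; rewrite mul_mx_diag !mxE; exact: mulrC.
rewrite det_mulmx det_diag mulrC; congr (_ * _).
by apply: eq_bigr => k _; rewrite mxE.
Qed.

Lemma quot_adjP (D : {set {set {set V}}}) u v :
  adj u v -> @edge_orbit T [set u; v] \notin D ->
  quot_adj D (vert_orbit u) (vert_orbit v).
Proof.
move=> uv uvD; rewrite /quot_adj !imset_f //=; apply/exists_inP.
exists u; first exact: orbit_refl.
by apply/exists_inP; exists v; [exact: orbit_refl | rewrite uv].
Qed.

(* The two matrices are inverse to each other, by summation by parts for the
   indicator function of the component of each point of S in the complement
   of D. *)
Lemma separates_det (D : {set {set {set V}}}) : D \subset quot_edges T -> #|D| = r ->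
  separates D -> \det (removal_mx D) ^+ 2 = 1.
Proof.
move=> /subsetP DE cD /forall_inP sepD; have [sym _ _ _ _] := tree.
have G0 : (#|G|%:Z : int) != 0 by rewrite eqz_nat -lt0n cardG_gt0.
pose chi x w : int := (connect (quot_adj D) (vert_orbit (tl x)) (vert_orbit w))%:Z.
pose dchi x (p : V * V) := chi x p.2 - chi x p.1.
have chiE (x : 'I_r) i : chi x (sg i) = (lift ord0 x == i)%:Z.
  rewrite /chi; congr (_%:Z); congr nat_of_bool; have [<-|xi] := eqVneq.
    by rewrite connect0.
  have xS : vert_orbit (tl x) \in S_orbits T by rewrite imset_f.
  have iS : vert_orbit (sg i) \in S_orbits T by rewrite imset_f.
  have /forall_inP/(_ _ iS)/implyP := sepD _ xS.
  by rewrite (inj_eq sg_inj) => /(_ xi) /negbTE.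
have dchi_out x u v : adj u v -> @edge_orbit T [set u; v] \notin D ->
    dchi x (u, v) = 0.
  move=> uv uvD; apply/eqP; rewrite subr_eq0; apply/eqP.
  rewrite /chi /=; congr (_%:Z); congr nat_of_bool; apply/idP/idP => xc.
    apply: connect_trans xc (connect1 (quot_adjP _ _)); first by rewrite sym.
    by rewrite setUC.
  exact: connect_trans xc (connect1 (quot_adjP uv uvD)).
have chiM x g w : g \in G -> chi x (g w) = chi x w.
  move=> gG; rewrite /chi (@vert_orbit_eq (g w) w) //.
  by apply/vert_orbitP; exists g.
have inv : removal_mx D *m (\matrix_(x, k) dchi x (edge_arc (nth set0 (enum D) k)))^T
    = 1%:M.
  apply/matrixP => i x; rewrite !mxE.
  pose f e' := quot_coef (tl i) e' * dchi x (edge_arc e').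
  rewrite (eq_bigr (fun k : 'I_r => f (nth set0 (enum D) k))); last first.
    by move=> k _; rewrite !mxE.
  rewrite -(big_nth_enum _ set0 f cD).
  (* [chi] does not change across an edge outside D, so those edges contribute 0. *)
  have -> : \sum_(e' in D) f e' = \sum_(e' in quot_edges T) f e'.
    apply/esym; rewrite (bigID (mem D)) /= [X in _ + X]big1 ?addr0.
      apply: eq_bigl => e'; apply: andb_idl; exact: DE.
    move=> e' /andP[/edge_arcP[]]; rewrite /f; case: edge_arc => u v /= uv ae e'D.
    by rewrite dchi_out ?mulr0 ?ae.
  apply: (mulIf G0); apply: mulr2n_int_inj.
  transitivity (\sum_p orbit_coef (tl i) p * dchi x p).
    rewrite sum_arcs.
    - rewrite mulr_suml -sumrMnl; apply: eq_bigr => e' e'E.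
      rewrite /f mulrAC quot_coefE // mulrnA -[_ *+ #|e'|]mulr_natr natz.
      by rewrite mulrAC.
    - move=> p; apply: contraNeq; rewrite mulf_eq0 negb_or.
      by case/andP => /orbit_coef_adj.
    - by move=> p; rewrite orbit_coefC /dchi /= -opprB mulrNN.
    - by move=> g p gG; rewrite orbit_coefM // /dchi /= !chiM.
  rewrite sum_orbit_coef => [|g p gG _]; last by rewrite /dchi /= !chiM.
  rewrite /dchi (sum_coboundary (chi x) (edge_chain_path tree _ _)).
  rewrite mulrnAl; congr (_ * _ *+ 2).
  under eq_bigr do rewrite boundary_path mulrBr.
  rewrite sumrB (bigD1 (tl i)) //= eqxx mulr1 big1 ?addr0; last first.
    by move=> v /negbTE->; rewrite mulr0.
  rewrite (bigD1 s0) //= eqxx mulr1 big1 ?addr0; last first.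
    by move=> v /negbTE->; rewrite mulr0.
  rewrite -sg0 !chiE (inj_eq lift_inj) [_ == ord0]eq_sym (negbTE (neq_lift _ _)).
  by rewrite subr0 [RHS]natz eq_sym.
have := congr1 (fun M => `|\det M|%N) inv; rewrite det_mulmx det1 abszM => /eqP.
rewrite muln_eq1 => /andP[/eqP det_eq1 _].
by rewrite -real_normK ?num_real // -abszE det_eq1.
Qed.

(** The paths to u and to v differ by the arc uv, whose translates all lie in an orbit outside D. *)
Lemma quot_coef_adj (D : {set {set {set V}}}) e' u v : e' \in quot_edges T ->
  e' \in D -> adj u v -> @edge_orbit T [set u; v] \notin D ->
  orbit_coef u (edge_arc e') = orbit_coef v (edge_arc e').
Proof.
move=> /edge_arcP[_ ae] e'D uv uvD; apply/eqP; rewrite eq_sym -subr_eq0 -sumrB.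
apply/eqP/big1 => g gG; set p := edge_arc e' in ae *.
transitivity (arc u v (g p.1, g p.2)).
  by rewrite -(path_chain_arc tree uv) -(path_chainB tree s0 u v) !ffunE.
rewrite ffunE; have [[pu pv]|_] := eqVneq.
  by case/negP: uvD; rewrite -pu -pv edge_orbitM // ae.
have [[pu pv]|//] := eqVneq.
by case/negP: uvD; rewrite setUC -pu -pv edge_orbitM // ae.
Qed.

Lemma quot_coef_connect (D : {set {set {set V}}}) e' X Y u v :
  e' \in quot_edges T -> e' \in D -> X \in quot_vert T ->
  connect (quot_adj D) X Y -> u \in X -> v \in Y -> quot_coef u e' = quot_coef v e'.
Proof.
move=> e'E e'D XV /connectP[q Xq ->] uX vY; rewrite /quot_coef; congr ((_ * _) %/ _)%Z.
have orbX Z x y : Z \in quot_vert T -> x \in Z -> y \in Z ->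
    orbit_coef x (edge_arc e') = orbit_coef y (edge_arc e').
  move=> /imsetP[z _ ->] xz yz; apply: orbit_coef_orbit.
  by rewrite (vert_orbit_eq yz).
elim: q X u XV Xq uX vY => [|Z q IHq] X u XV /=; first by move=> _; apply: orbX.
case/andP => /and3P[_ ZV /exists_inP[x xX /exists_inP[y yZ /andP[xy xyD]]]] Zq uX vY.
rewrite (orbX X u x) // (quot_coef_adj e'E e'D xy xyD).
exact: (IHq Z y).
Qed.

(** Two points of S/F connected outside D have equal coefficients on D: two rows coincide or, if one
    of the points is the orbit of [s0], the other row is zero. *)
Lemma nonseparates_det (D : {set {set {set V}}}) : D \subset quot_edges T -> #|D| = r ->
  ~~ separates D -> \det (removal_mx D) = 0.
Proof.
move=> /subsetP DE cD.
case/forall_inPn => X /imsetP[x xS ->] /forall_inPn[Y /imsetP[y yS ->]].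
rewrite negb_imply negbK => /andP[neq_xy xy].
have [i xi] := sg_cover xS; have [j yj] := sg_cover yS.
rewrite (vert_orbit_eq xi) (vert_orbit_eq yj) in neq_xy xy.
have neq_ij : i != j by apply: contraNneq neq_xy => ->.
have coef_eq e' : e' \in D -> quot_coef (sg i) e' = quot_coef (sg j) e'.
  move=> e'D; apply: quot_coef_connect xy _ _ => //; try exact: orbit_refl.
  - exact: DE.
  - exact: imset_f.
have nthD (k : 'I_r) : nth set0 (enum D) k \in D.
  by rewrite -mem_enum mem_nth // -cardE cD.
have coef0 e' : quot_coef (sg ord0) e' = 0.
  by rewrite sg0 /quot_coef orbit_coef0 mul0r div0z.
have det0 (l : 'I_r) : (forall k, removal_mx D l k = 0) -> \det (removal_mx D) = 0.
  by move=> l0; rewrite (expand_det_row _ l) big1 // => k _; rewrite l0 mul0r.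
case: (unliftP ord0 i) => [i'|] iE; case: (unliftP ord0 j) => [j'|] jE.
- apply: (@determinant_alternate _ _ _ i' j').
    by apply: contraNneq neq_ij => ij'; rewrite iE jE ij'.
  by move=> k; rewrite !mxE -iE -jE coef_eq.
- by apply: (det0 i') => k; rewrite mxE -iE coef_eq // jE coef0.
- by apply: (det0 j') => k; rewrite mxE -jE -coef_eq ?nthD // iE coef0.
- by rewrite iE jE eqxx in neq_ij.
Qed.

Lemma tamagawa_formula : (tamagawa T)%:R =
  (\prod_j #|vert_orbit (sg j)|%:R) *
  \sum_(D : {set {set {set V}}} |
      [&& D \subset quot_edges T, #|D| == r & separates D])
    \prod_(e' in D) quot_len e' :> rat.
Proof.
have len_ge0 e' : 0 <= @quot_len T e'.
  by rewrite /quot_len; case: pickP => // e _; rewrite divr_ge0.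
have det_eq : (\det coinv_mx)%:~R = (\prod_j #|vert_orbit (sg j)|%:R) *
  \sum_(D : {set {set {set V}}} |
      [&& D \subset quot_edges T, #|D| == r & separates D])
    \prod_(e' in D) quot_len e' :> rat.
  rewrite det_coinv_mx det_quot_gram; congr (_ * _).
  rewrite (bigID (@separates T)) /= [X in _ + X]big1 ?addr0.
    apply: eq_big => [D|D /andP[/andP[DE /eqP cD] sepD]]; first by rewrite andbA.
    by rewrite -rmorphXn /= separates_det // mulr1.
  move=> D /andP[/andP[DE /eqP cD] sepD].
  by rewrite nonseparates_det // expr0n mulr0.
rewrite tamagawa_det -det_eq; suff det_ge0 : 0 <= \det coinv_mx.
  by rewrite pmulrn gez0_abs.
rewrite -(ler0z rat) det_eq mulr_ge0 ?prodr_ge0 ?sumr_ge0 // => D _.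
by rewrite prodr_ge0.
Qed.

End BYTree.

Theorem theorem1p5 (T : by_tree) (r Q : nat)
    (hsimple : simple T) (hpos : positive T) (hB : parity_B T)
    (hr : #|S_orbits T| = r.+1)
    (hQ : Q = (\prod_(O in S_orbits T) #|O|)%N) :
  (tamagawa T)%:R =
    Q%:R * \sum_(D : {set {set {set vert T}}} |
                   [&& D \subset quot_edges T, #|D| == r & separates D])
             \prod_(e' in D) quot_len e' :> rat.
Proof.
have [SE0 _ _] := hsimple.
have repr_orbit (i : 'I_r.+1) : exists s,
    s \in SV T /\ enum_val (cast_ord (esym hr) i) = vert_orbit s.
  by have /imsetP[s sS ->] := enum_valP (cast_ord (esym hr) i); exists s.
(* Any representatives of the orbits serve; the one with index 0 becomes the base point. *)
have [sg sgP] := choice repr_orbit.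
have sgS i : sg i \in SV T by case: (sgP i).
have sg_inj : injective (fun i => vert_orbit (sg i)).
  move=> i j /=; case: (sgP i) (sgP j) => _ <- [_ <-].
  by move/enum_val_inj/cast_ord_inj.
have sg_cover s : s \in SV T -> exists i, s \in vert_orbit (sg i).
  move=> sS; have sO : vert_orbit s \in S_orbits T by apply: imset_f.
  exists (cast_ord hr (enum_rank_in sO (vert_orbit s))).
  have [_ <-] := sgP (cast_ord hr (enum_rank_in sO (vert_orbit s))).
  by rewrite cast_ordK enum_rankK_in // orbit_refl.
rewrite (tamagawa_formula SE0 (sgS ord0) hpos hB (erefl _) sgS sg_inj sg_cover).
congr (_ * _); rewrite hQ natr_prod.
transitivity (\prod_(O in [set vert_orbit (sg j) | j in 'I_r.+1]) #|O|%:R : rat).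
  by rewrite big_imset => [|i j _ _]; [apply: eq_bigl | apply: sg_inj].
apply: eq_bigl => O; apply/imsetP/idP => [[i _ ->]|]; first by rewrite imset_f.
move=> OS; exists (cast_ord hr (enum_rank_in OS O)) => //.
have [_ <-] := sgP (cast_ord hr (enum_rank_in OS O)).
by rewrite cast_ordK enum_rankK_in.
Qed.
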